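(* Let $\Gamma$ satisfy volume control with parameter $\alpha$ and the weak Poincaré inequality. Let $A\subset\mathbb V$ be finite and nonempty, and let $\mu_{xy}=\mu_{yx}\in[0,1]$, $V_x\ge 0$ be arbitrary. Then: (i) (Upper bound) There is a constant $C>0$ depending only on $\Gamma$ (in particular independent of $A$, $\mu$, $V$) such that $N(E)\le N_u(CE)$ for all $E>0$. (ii) (Lower bound) There are constants $c_1,c_2,c_3,c_4,c_1',c_2',c_3',c_4',c^*>0$ depending only on $\Gamma$ such that for every $0<\kappa<1/4$: $$N(E)\ge c_1\kappa^{\alpha}N_u(c_3\kappa^{\alpha+2}E)-c_2N_u(c_4\kappa^{\alpha+4}E)\quad\text{for } E\le c^*\kappa^{-4},$$ $$N(E)\ge c_1'N_u(c_3'\kappa^{2}E)-c_2'N_u(c_4'\kappa^{4}E)\quad\text{for } E> c^*\kappa^{-4}.$$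
   Context: Graph: $\Gamma=(\mathbb V,\mathcal E)$ is a connected simple unweighted graph with countably infinite vertex set; $x\sim y$ means $\{x,y\}\in\mathcal E$; $\deg(x)=\#\{y:y\sim x\}$; $d_0$ is the shortest-path metric; for $x\in\mathbb V$ and real $r\ge 0$, $B(x,r)=\{y\in\mathbb V:d_0(x,y)\le r\}$; $|S|$ denotes cardinality. Volume control (Ahlfors $\alpha$-regularity): there are $\alpha\ge 1$ and $C_L,C_U>0$ with $C_Lr^\alpha\le |B(x,r)|\le C_Ur^\alpha$ for all $x\in\mathbb V$, $r\ge 1$ (hence $M_\Gamma:=\sup_x\deg(x)<\infty$). Operator: given symmetric bond strengths $\mu_{xy}=\mu_{yx}\in[0,1]$ ($x\sim y$) and a potential $V_x\ge 0$, for finite nonempty $A\subset\mathbb V$ let $H^A$ act on $\ell^2(A)$ by $H^Af(x)=\deg(x)f(x)-\sum_{y\in A,\,y\sim x}\mu_{xy}f(y)+V_xf(x)$ ($\deg$ being the degree in $\Gamma$). $H^A$ is positive definite; the landscape function $u=u_A:A\to(0,\infty)$ is the unique solution of $H^Au=1$ on $A$. The integrated density of states is $N(E)=N^A(E)=|A|^{-1}\#\{\text{eigenvalues of }H^A\text{ (with multiplicity)}\le E\}$. Coverings: a covering of radius $R$ is a family $\mathcal P=\{B(z_i,R)\}_i$ with countably many centers $z_i\in\mathbb V$ and union $\mathbb V$; it has overlap constant $b$ if $\sup_{y\in\mathbb V}\#\{i:y\in B(z_i,R)\}\le b$. $\mathcal P|_A=\{B\in\mathcal P:B\cap A\neq\emptyset\}$.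 For $E>0$ the landscape counting function is $N_u^{\mathcal P,A}(E)=|A|^{-1}\#\{B\in\mathcal P|_A:\min_{x\in B\cap A}1/u(x)\le E\}$. Under volume control there is a constant $b_\Gamma$ such that for every $R>0$ coverings of radius $R$ with overlap constant $b_\Gamma$ exist; $N_u(E)$ denotes $N_u^{\mathcal P,A}(E)$ for any covering $\mathcal P$ of radius $E^{-1/2}$ with overlap constant $b_\Gamma$ (different such choices change $N_u$ only by a multiplicative constant depending on $\Gamma$, absorbed into the constants of the statement). Weak Poincaré inequality: there exist $C_P>0$, $\lambda\ge1$ such that for all $x\in\mathbb V$, $r\ge1$, with $B=B(x,r)$, $B^*=B(x,\lambda r)$ and every $f:B^*\to\mathbb R$, $\sum_{y\in B}(f(y)-\bar f^B)^2\le C_Pr^2\sum_{y,z\in B^*,\,y\sim z}(f(y)-f(z))^2$, where $\bar f^B=\sum_{y\in B}f(y)\deg(y)/\sum_{y\in B}\deg(y)$. *)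

(* Defs.v *)
From HB Require Import structures.
From mathcomp Require Import all_boot all_order all_algebra.
From mathcomp Require Import finmap.
From mathcomp Require Import all_classical all_reals all_analysis.
Set Implicit Arguments. Unset Strict Implicit. Unset Printing Implicit Defensive.
Import Order.TTheory GRing.Theory Num.Theory.
Local Open Scope classical_set_scope.
Local Open Scope ring_scope.

(* ---------- The graph Gamma ----------
   Vertices: a countable type V.  The (locally finite) graph is given by
   neighbour lists nb x = the list of y with x ~ y (no repetition). *)
Section Graph.
Variable V : countType.
Variable nb : V -> seq V.

Definition adj (x y : V) : bool := y \in nb x.
Definition deg (x : V) : nat := size (nb x).

Definition simple_graph : Prop :=
  [/\ forall x, uniq (nb x), forall x, ~~ adj x x & forall x y, adj x y -> adj y x].

Definition dist_le (x y : V) (n : nat) : Prop :=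
  exists p : seq V, [/\ path adj x p, last x p = y & (size p <= n)%N].

Definition connected_graph : Prop := forall x y : V, exists n, dist_le x y n.

Definition infinite_vertices : Prop := forall s : seq V, exists x, x \notin s.

Definition ball {R : realType} (x : V) (r : R) : set V :=
  [set y | exists n : nat, n%:R <= r /\ dist_le x y n].

Definition vcard {R : realType} (S : set V) : R := (#|` fset_set S|)%:R.

Definition volume_control {R : realType} (alpha : R) : Prop :=
  exists CL CU : R, [/\ 0 < CL, 0 < CU &
    forall (x : V) (r : R), 1 <= r ->
      [/\ finite_set (ball x r),
          CL * r `^ alpha <= vcard (ball x r) &
          vcard (ball x r) <= CU * r `^ alpha]].

Definition weak_poincare {R : realType} : Prop :=
  exists CP lam : R, [/\ 0 < CP, 1 <= lam &
    forall (x : V) (r : R), 1 <= r -> forall f : V -> R,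
      let B := fset_set (ball x r) in
      let Bs := fset_set (ball x (lam * r)) in
      let fbar := (\sum_(y <- B) f y * (deg y)%:R) / (\sum_(y <- B) (deg y)%:R) in
      \sum_(y <- B) (f y - fbar) ^+ 2 <=
        CP * r ^+ 2 * \sum_(y <- Bs) \sum_(z <- Bs | adj y z) (f y - f z) ^+ 2].

(* ---------- The operator H^A on l^2(A) ----------
   A finite nonempty set A is given as a duplicate-free nonempty list;
   ell^2(A) is identified with R^(size A) via i |-> tnth A i. *)
Definition avert (A : seq V) (i : 'I_(size A)) : V := tnth (in_tuple A) i.

Definition Hmat {R : realType} (mu : V -> V -> R) (Vp : V -> R) (A : seq V)
  : 'M[R]_(size A) :=
  \matrix_(i, j) ((if i == j then (deg (avert i))%:R + Vp (avert i) else 0)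
                  - (if adj (avert i) (avert j) then mu (avert i) (avert j) else 0)).

Definition landscape {R : realType} (mu : V -> V -> R) (Vp : V -> R) (A : seq V)
  : 'cV[R]_(size A) := invmx (Hmat mu Vp A) *m const_mx 1.

Definition IDS {R : realType} (mu : V -> V -> R) (Vp : V -> R) (A : seq V) (E : R) : R :=
  let p := char_poly (Hmat mu Vp A) in
  (\sum_(l <- fset_set [set l : R | root p l /\ l <= E]) mup l p)%:R / (size A)%:R.

Definition covering {R : realType} (z : nat -> V) (Rr : R) (b : nat) : Prop :=
  (forall y : V, exists i, ball (z i) Rr y) /\
  (forall y : V, finite_set [set i | ball (z i) Rr y] /\
                 (#|` fset_set [set i | ball (z i) Rr y]| <= b)%N).

(* N_u^{P,A}(E) = |A|^{-1} #{ i : B(z i,Rr) meets A and min_{x in B cap A} 1/u(x) <= E } *)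
Definition Nu_cov {R : realType} (mu : V -> V -> R) (Vp : V -> R) (A : seq V)
  (z : nat -> V) (Rr : R) (E : R) : R :=
  (#|` fset_set [set i : nat | exists k : 'I_(size A),
        ball (z i) Rr (avert k) /\ (landscape mu Vp A k ord0)^-1 <= E] |)%:R
  / (size A)%:R.

Definition Nu {R : realType} (mu : V -> V -> R) (Vp : V -> R) (A : seq V)
  (Pc : R -> nat -> V) (E : R) : R :=
  Nu_cov mu Vp A (Pc (E `^ (- 2^-1))) (E `^ (- 2^-1)) E.

Definition admissible {R : realType} (mu : V -> V -> R) (Vp : V -> R) (A : seq V) : Prop :=
  [/\ uniq A, A != [::],
      forall x y, adj x y -> mu x y = mu y x /\ 0 <= mu x y <= 1
    & forall x, 0 <= Vp x].

End Graph.

(* Main.v *)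
(** Write [Q f] for the quadratic form of [H^A] and [u] for the landscape
function. Two facts drive both bounds: [Q (chi * g)] equals
[sum chi^2 g (H g)] plus a gradient term in [chi] (with [g = u] this gives
[Q f >= sum f^2 / u]), and [Q] dominates a quarter of the graph energy.

Upper bound: if [f] has degree-weighted mean zero on every ball of radius
[R = (C E)^(-1/2)] that contains a point with [1/u <= C E], then the mass of [f]
on those balls is controlled by the Poincare inequality and its mass elsewhere
by [sum f^2 / u]; hence [Q f > E |f|^2], and min-max bounds the number of
eigenvalues by the number of such balls.

Lower bound: covering by balls of volume comparable to the support and using
the Poincare inequality gives a Faber-Krahn inequality, and De Giorgi iteration
on [(u - k)_+] then yields a mean value inequality: [u z >= r^2] forces
[sum_(B(z, r)) u^2 >= c r^4 |B(z, r)|]. So for [R3 = E3^(-1/2)] and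
[R4 = E4^(-1/2)], around a point [z] with [u z >= R3^2] such that [u <= R4^2] on
[B(z, R4)], the function "tent of radius R4 times u" has Rayleigh quotient at
most [E]. Such points taken far apart give mutually orthogonal test functions.
With [R4 = R3 / kappa] one statement covers both regimes of the theorem: for
[E > c* kappa^(-4)] all balls are single vertices and no power of [kappa] is
lost. *)
Require Import Defs.
From HB Require Import structures.
From mathcomp Require Import all_boot all_order all_algebra.
From mathcomp Require Import finmap.
From mathcomp Require Import all_classical all_reals all_analysis.
From mathcomp Require Import sesquilinear spectral complex.
From mathcomp Require Import ring lra zify.
Import Order.TTheory GRing.Theory Num.Theory.
Local Open Scope classical_set_scope.
Local Open Scope ring_scope.
Set Implicit Arguments. Unset Strict Implicit. Unset Printing Implicit Defensive.

(** * Min-max for real symmetric matrices *)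

Section SymmetricMatrices.
Local Open Scope sesquilinear_scope.
Variables (R : rcfType) (n : nat).
Local Notation iota := (real_complex R).
Local Notation MC := (map_mx iota).

Lemma trC_real m p (A : 'M[R]_(m, p)) : (MC A) ^t* = MC A^T.
Proof. by apply/matrixP=> i j; rewrite !mxE -[LHS]/(conjc _) conjc_real. Qed.

Lemma char_poly_conj (F : fieldType) (P Q D : 'M[F]_n) :
  P *m Q = 1%:M -> char_poly (P *m D *m Q) = char_poly D.
Proof.
move=> PQ; rewrite /char_poly.
have PQ' : map_mx polyC P *m map_mx polyC Q = 1%:M by rewrite -map_mxM PQ map_mx1.
have -> : char_poly_mx (P *m D *m Q) =
    map_mx polyC P *m char_poly_mx D *m map_mx polyC Q.
  rewrite /char_poly_mx mulmxBr mulmxBl !map_mxM; congr (_ - _).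
  by rewrite scalar_mxC -mulmxA PQ' mulmx1.
rewrite !det_mulmx mulrAC -det_mulmx PQ' det1 mul1r //.
Qed.

(** Over [R[i]] the matrix [H] is Hermitian, so the complex spectral theorem applies and its
    diagonal is real. The matrix [P] stays complex; only the factorization of the characteristic
    polynomial is brought back to [R], by injectivity of the embedding. *)
Lemma sym_spectral (H : 'M[R]_n) : H^T = H ->
  exists (P : 'M[R[i]]_n) (r : 'I_n -> R),
   [/\ P *m P ^t* = 1%:M, P ^t* *m P = 1%:M,
       MC H = P ^t* *m diag_mx (\row_i iota (r i)) *m P
     & char_poly H = \prod_i ('X - (r i)%:P)].
Proof.
move=> Hs; set A := MC H.
have Ah : A \is hermsymmx.
  by apply/is_hermitianmxP; rewrite expr0 scale1r trC_real Hs.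
have Dr := hermitian_spectral_diag_real Ah.
have /hermitian_normalmx/orthomx_spectralP AE := Ah.
have Pu := spectral_unitarymx A; set P := spectralmx A in AE Pu *.
set D := spectral_diag A in AE Dr *.
have PP : P *m P ^t* = 1%:M by apply/unitarymxP.
have PP' : P ^t* *m P = 1%:M by apply: mulmx1C.
have DE i : iota (complex.Re (D 0 i)) = D 0 i.
  by apply: RRe_real; move/mxOverP: Dr; apply.
pose r i := complex.Re (D 0 i).
have DE' : diag_mx (\row_i iota (r i)) = diag_mx D.
  by congr diag_mx; apply/rowP => i; rewrite mxE; exact: DE.
rewrite invmx_unitary // in AE.
exists P, r; split=> //; first by rewrite DE'.
apply: (map_poly_inj iota); rewrite map_char_poly -/A {1}AE char_poly_conj //.
rewrite char_poly_trig ?diag_mx_is_trig // rmorph_prod; apply: eq_bigr => i _.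
rewrite rmorphB /= map_polyX map_polyC mxE eqxx mulr1n; congr (_ - _%:P); exact/esym/DE.
Qed.

Definition quad m (H : 'M[R]_n) (f : 'M[R]_(m, n)) := f *m H *m f^T.

(** The cross terms cancel because [y H x^T = x H y^T]. A complex vector found through the spectral
    theorem can thus be traded for two real ones. *)
Lemma quadC_ReIm (H : 'M[R]_n) (x y : 'rV[R]_n) : H^T = H ->
  (MC x + 'i%C *: MC y) *m MC H *m (MC x + 'i%C *: MC y) ^t*
   = MC (quad H x + quad H y).
Proof.
move=> Hs.
have -> : (MC x + 'i%C *: MC y) ^t* = MC x^T - 'i%C *: MC y^T.
  rewrite linearD /= linearZ /= map_mxD map_mxZ !trC_real.
  congr (_ + _); rewrite -scaleNr; congr (_ *: _).
  by rewrite -[LHS]/(conjc _) /=; apply/eqP; rewrite eq_complex /= oppr0 !eqxx.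
rewrite mulmxBr !mulmxDl -!scalemxAl -!scalemxAr -!map_mxM.
have yx : y *m H *m x^T = x *m H *m y^T.
  have sc (A : 'M[R]_1) : A^T = A by apply/matrixP => i j; rewrite mxE !ord1.
  by rewrite -[LHS]sc !trmx_mul trmxK Hs mulmxA.
rewrite yx /quad map_mxD scalerA -expr2 sqr_i scaleN1r.
by rewrite opprD opprK addrA addrK.
Qed.

Section MinMax.
Variables (H : 'M[R]_n) (r : 'I_n -> R) (P : 'M[R[i]]_n).
Hypothesis Hs : H^T = H.
Hypotheses (PP : P *m P ^t* = 1%:M) (PP' : P ^t* *m P = 1%:M).
Hypothesis HE : MC H = P ^t* *m diag_mx (\row_i iota (r i)) *m P.

Lemma quadC_spectral (w : 'rV[R[i]]_n) :
  ((w *m P) *m MC H *m (w *m P) ^t*) 0 0 = \sum_i iota (r i) * `|w 0 i| ^+ 2.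
Proof.
rewrite trmx_mul map_mxM HE !mulmxA -(mulmxA w) PP mulmx1 -(mulmxA _ P).
rewrite PP mulmx1 mxE; apply: eq_bigr => i _.
by rewrite mul_mx_diag !mxE normCK mulrAC mulrC.
Qed.

Lemma normC_spectral (w : 'rV[R[i]]_n) :
  ((w *m P) *m (w *m P) ^t*) 0 0 = \sum_i `|w 0 i| ^+ 2.
Proof.
rewrite trmx_mul map_mxM !mulmxA -(mulmxA w) PP mulmx1 mxE.
by apply: eq_bigr => i _; rewrite !mxE normCK.
Qed.

(** If more than [m] eigenvalues were at most [E], their eigenvectors would span a space of
    dimension above [m], in which the [m] conditions of [L] have a nonzero solution [g]. Its form is
    at most [E |g|^2], yet its real and imaginary parts both satisfy the conditions and at least one
    of them is nonzero. *)
Lemma card_eig_le (E : R) m (L : 'M[R]_(n, m)) :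
  (forall f : 'rV[R]_n, f *m L = 0 -> f != 0 ->
     E * quad 1%:M f 0 0 < quad H f 0 0) ->
  (#|[pred i | (r i <= E)%R]| <= m)%N.
Proof.
move=> hL; rewrite leqNgt; apply/negP => mI.
set I := [pred i | r i <= E] in mI.
pose sel : 'M[R[i]]_(#|I|, n) := rowsub enum_val 1%:M.
have /rowV0Pn[v /sub_kermxP vM v0] : kermx (sel *m P *m MC L) != 0.
  rewrite kermx_eq0 /row_free neq_ltn (leq_ltn_trans (rank_leq_col _)) //.
pose w := v *m sel.
have wI i : i \notin I -> w 0 i = 0.
  move=> iI; rewrite mxE big1 // => j _; rewrite !mxE.
  case: eqP => [ij|]; last by rewrite mulr0.
  by move: iI; rewrite -ij enum_valP.
have w0 : w != 0.
  apply: contraNneq v0 => w0; apply/eqP/rowP => j.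
  have /rowP/(_ (enum_val j)) := w0; rewrite !mxE (bigD1 j) //= !mxE eqxx mulr1.
  rewrite big1 ?addr0 // => k kj; rewrite !mxE.
  by rewrite (inj_eq enum_val_inj) (negPf kj) mulr0.
pose g := w *m P.
pose x := map_mx (@complex.Re R) g; pose y := map_mx (@complex.Im R) g.
have gE : g = MC x + 'i%C *: MC y.
  by apply/rowP => i; rewrite !mxE -complexE.
have g0 : g != 0.
  apply: contraNneq w0 => g0.
  by rewrite -[w]mulmx1 -PP mulmxA -/g g0 mul0mx.
have gL : g *m MC L = 0 by rewrite /g /w -mulmxA -mulmxA (mulmxA sel).
have xyL : x *m L = 0 /\ y *m L = 0.
  move: gL; rewrite gE mulmxDl -scalemxAl -!map_mxM => /matrixP gL.
  by split; apply/matrixP => i j; move: (gL i j); rewrite !mxE => /eqP;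
    rewrite eq_complex /= !(mul0r, mulr0, mul1r, addr0, add0r, subr0) => /andP[/eqP ? /eqP ?].
have lt : E * (quad 1%:M x 0 0 + quad 1%:M y 0 0) < quad H x 0 0 + quad H y 0 0.
  have q0 z : z = 0 :> 'rV[R]_n -> (quad 1%:M z 0 0 = 0) * (quad H z 0 0 = 0).
    by move=> ->; rewrite /quad !mul0mx !mxE.
  rewrite mulrDr.
  have [x0|x0] := eqVneq x 0; have [y0|y0] := eqVneq y 0.
  - by move: g0; rewrite gE x0 y0 !map_mx0 scaler0 addr0 eqxx.
  - by rewrite !(q0 _ x0) mulr0 !add0r; apply: hL => //; case: xyL.
  - by rewrite !(q0 _ y0) mulr0 !addr0; apply: hL => //; case: xyL.
  - by apply: ltrD; apply: hL => //; case: xyL.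
have e1 := quadC_ReIm x y (trmx1 _ _ : 1%:M^T = 1%:M).
have e2 := quadC_ReIm x y Hs.
rewrite -gE in e1 e2; rewrite map_mx1 mulmx1 in e1.
have e3 := normC_spectral w; have e4 := quadC_spectral w.
rewrite -/g e1 in e3; rewrite -/g e2 in e4.
rewrite 2!mxE in e3; rewrite 2!mxE in e4.
suff : iota (quad H x 0 0 + quad H y 0 0)
    <= iota (E * (quad 1%:M x 0 0 + quad 1%:M y 0 0)).
  by rewrite lecR leNgt lt.
rewrite rmorphM /= e3 e4 mulr_sumr; apply: ler_sum => i _.
have [iI|/wI->] := boolP (i \in I); last by rewrite normr0 expr0n /= !mulr0.
by apply: ler_wpM2r; rewrite ?exprn_ge0 // lecR; move: iI; rewrite inE.
Qed.

(** The rows of [W] are orthogonal for both forms, so every combination of them has quotient at most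
    [E]. With fewer than [m] eigenvalues up to [E], some nonzero combination would be orthogonal to
    all their eigenvectors, and its quotient would exceed [E]. *)
Lemma card_eig_ge (E : R) m (W : 'M[R]_(m, n)) (a d : 'rV[R]_m) :
  quad H W = diag_mx a -> quad 1%:M W = diag_mx d ->
  (forall j, 0 < d 0 j) -> (forall j, a 0 j <= E * d 0 j) ->
  (m <= #|[pred i | (r i <= E)%R]|)%N.
Proof.
move=> Wa Wd d0 ad; rewrite leqNgt; apply/negP => mI.
set I := [pred i | r i <= E] in mI.
pose sel : 'M[R[i]]_(n, #|I|) := colsub enum_val 1%:M.
have /rowV0Pn[v /sub_kermxP vM v0] : kermx (MC W *m P ^t* *m sel) != 0.
  rewrite kermx_eq0 /row_free neq_ltn (leq_ltn_trans (rank_leq_col _)) //.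
pose g := v *m MC W; pose w := g *m P ^t*.
have gw : g = w *m P by rewrite /w -mulmxA PP' mulmx1.
have selE (u : 'rV[R[i]]_n) k : (u *m sel) 0 k = u 0 (enum_val k).
  rewrite mxE (bigD1 (enum_val k)) //= !mxE eqxx mulr1 big1 ?addr0 // => l lk.
  by rewrite !mxE (negPf lk) mulr0.
have wI i : i \in I -> w 0 i = 0.
  move=> iI; move: vM; rewrite !mulmxA -/g -/w => /rowP/(_ (enum_rank_in iI i)).
  by rewrite selE enum_rankK_in // => ->; rewrite mxE.
have qd (K : 'M[R]_n) (c : 'rV[R]_m) : quad K W = diag_mx c ->
   (g *m MC K *m g ^t*) 0 0 = \sum_j iota (c 0 j) * `|v 0 j| ^+ 2.
  move=> Kc; rewrite /g trmx_mul map_mxM trC_real !mulmxA.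
  have -> : v *m MC W *m MC K *m MC W^T = v *m MC (quad K W).
    by rewrite /quad !map_mxM !mulmxA.
  rewrite Kc map_diag_mx mxE; apply: eq_bigr => j _.
  by rewrite mul_mx_diag !mxE normCK mulrAC mulrC.
have e1 := qd _ _ Wd; have e2 := qd _ _ Wa; rewrite map_mx1 mulmx1 in e1.
have e3 := normC_spectral w; have e4 := quadC_spectral w.
rewrite -gw e1 in e3; rewrite -gw e2 in e4.
have [j0 vj0] : exists j, v 0 j != 0.
  by apply/existsP; apply: contraNT v0 => /existsPn h;
    apply/eqP/rowP => j; rewrite mxE; apply/eqP; rewrite -[_ == _]negbK h.
have dpos : 0 < \sum_j iota (d 0 j) * `|v 0 j| ^+ 2.
  rewrite (bigD1 j0) //= ltr_wpDr ?sumr_ge0 //.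
    by move=> j _; rewrite mulr_ge0 ?exprn_ge0 // ler0c ltW.
  by rewrite mulr_gt0 ?exprn_gt0 ?normr_gt0 // ltcR.
have [i0 wi0] : exists i, w 0 i != 0.
  apply/existsP; apply: contraTT dpos => /existsPn h.
  rewrite e3 big1 ?ltxx // => i _.
  by move: (h i); rewrite negbK => /eqP ->; rewrite normr0 expr0n.
suff : iota E * \sum_j iota (d 0 j) * `|v 0 j| ^+ 2
     < \sum_j iota (a 0 j) * `|v 0 j| ^+ 2.
  move/lt_geF/negP; apply; rewrite mulr_sumr; apply: ler_sum => j _.
  rewrite mulrA; apply: ler_wpM2r; first by rewrite exprn_ge0.
  by rewrite -(rmorphM iota) lecR.
have rE i : w 0 i != 0 -> E < r i.
  by move=> wi; rewrite ltNge; apply: contraNN wi => ri; rewrite wI // inE.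
rewrite e3 e4 mulr_sumr (bigD1 i0) //= [ltRHS](bigD1 i0) //=.
apply: ltr_leD.
  by rewrite ltr_pM2r ?ltcR ?rE // exprn_gt0 ?normr_gt0.
apply: ler_sum => i _; have [->|wi] := eqVneq (w 0 i) 0.
  by rewrite normr0 expr0n /= !mulr0.
by apply: ler_wpM2r; rewrite ?exprn_ge0 // lecR ltW ?rE.
Qed.

End MinMax.
End SymmetricMatrices.

(** * Eigenvalue counts read off the characteristic polynomial *)

Definition eig_count {R : realType} n (H : 'M[R]_n) (E : R) : nat :=
  (\sum_(l <- fset_set [set l : R | root (char_poly H) l /\ (l <= E)%R])
     mup l (char_poly H))%N.

(** The multiplicity [mup] of a root is its number of occurrences in the list of the [r i];
    exchanging the two sums counts each entry up to [E] once. *)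
Lemma eig_countE (R : realType) n (H : 'M[R]_n) (r : 'I_n -> R) (E : R) :
  char_poly H = \prod_i ('X - (r i)%:P) ->
  eig_count H E = #|[pred i | (r i <= E)%R]|.
Proof.
move=> pE; pose s := [seq r i | i <- enum 'I_n].
have sE : char_poly H = \prod_(y <- s) ('X - y%:P).
  by rewrite pE big_map big_enum.
have rootE l : root (char_poly H) l = (l \in s) by rewrite sE root_prod_XsubC.
have fin : finite_set [set l : R | root (char_poly H) l /\ (l <= E)%R].
  apply: (@sub_finite_set _ _ [set` s]) => [l /= []|]; last exact: finite_seq.
  by rewrite rootE.
rewrite /eig_count.
transitivity (count (fun l => l <= E) s).
  set F := fset_set _.
  have FE l : (l \in F) = (l \in s) && (l <= E).
    rewrite in_fset_set //; apply/idP/andP; rewrite inE /= rootE //.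
  rewrite sE (eq_bigr (fun l => count_mem l s)) => [|l _]; last exact: mu_prod_XsubC.
  rewrite -size_filter -[RHS]sum1_size big_filter.
  rewrite (eq_bigr (fun l => \sum_(i <- s | i == l) 1)%N) => [|l _]; last first.
    by rewrite -sum1_count.
  rewrite (exchange_big_dep xpredT) //= [RHS]big_mkcond /=.
  apply: eq_big_seq => l ls.
  rewrite sum1_count (@eq_count _ _ (pred1 l)) => [|i]; last exact: eq_sym.
  by rewrite count_uniq_mem ?fset_uniq // FE ls; case: ifP.
rewrite /s enumT count_map cardE /enum_mem size_filter; exact: eq_count.
Qed.

Lemma eig_count_le (R : realType) n (H : 'M[R]_n) (E : R) m (L : 'M[R]_(n, m)) :
  H^T = H ->
  (forall f : 'rV[R]_n, f *m L = 0 -> f != 0 ->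
     E * quad 1%:M f 0 0 < quad H f 0 0) ->
  (eig_count H E <= m)%N.
Proof.
move=> Hs hL; have [P [r [PP _ HE pE]]] := sym_spectral Hs.
rewrite (eig_countE E pE); exact: (card_eig_le Hs PP HE hL).
Qed.

Lemma eig_count_ge (R : realType) n (H : 'M[R]_n) (E : R) m (W : 'M[R]_(m, n))
    (a d : 'rV[R]_m) : H^T = H ->
  quad H W = diag_mx a -> quad 1%:M W = diag_mx d ->
  (forall j, 0 < d 0 j) -> (forall j, a 0 j <= E * d 0 j) ->
  (m <= eig_count H E)%N.
Proof.
move=> Hs Wa Wd d0 ad; have [P [r [PP PP' HE pE]]] := sym_spectral Hs.
rewrite (eig_countE E pE); exact: (card_eig_ge PP PP' HE Wa Wd).
Qed.

(** * Balls and coverings *)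

Section GraphMetric.
Variables (V : countType) (nb : V -> seq V).
Hypotheses (simple : simple_graph nb) (conn : connected_graph nb).
Local Notation adj := (adj nb).

Lemma adj_sym x y : adj x y = adj y x.
Proof. by case: simple => _ _ h; apply/idP/idP; apply: h. Qed.

Lemma dist_leW x y m n : (m <= n)%N -> dist_le nb x y m -> dist_le nb x y n.
Proof. by move=> mn [p [px py pm]]; exists p; split=> //; apply: leq_trans mn. Qed.

Lemma dist_le_trans x y z m n :
  dist_le nb x y m -> dist_le nb y z n -> dist_le nb x z (m + n).
Proof.
move=> [p [px py pm]] [q [qy qz qn]]; exists (p ++ q).
by rewrite cat_path last_cat px py size_cat leq_add.
Qed.

Lemma dist_le_sym x y n : dist_le nb x y n -> dist_le nb y x n.
Proof.
move=> [p [px py pn]]; exists (rev (belast x p)); split.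
- rewrite -py rev_path; apply: sub_path px => a b; by rewrite adj_sym.
- by case: p px py {pn} => [|a p] //= _ _; rewrite rev_cons last_rcons.
- by rewrite size_rev size_belast.
Qed.

Lemma dist_le_ex x y : exists n, `[< dist_le nb x y n >].
Proof. by have [n h] := conn x y; exists n; apply/asboolP. Qed.

Definition gdist x y : nat := ex_minn (dist_le_ex x y).

Lemma gdistP x y n : dist_le nb x y n <-> (gdist x y <= n)%N.
Proof.
rewrite /gdist; case: ex_minnP => m /asboolP hm mmin; split.
  by move=> /asboolP; apply: mmin.
by move=> mn; apply: dist_leW hm.
Qed.

Lemma gdistxx x : gdist x x = 0%N.
Proof. by apply/eqP; rewrite -leqn0; apply/gdistP; exists [::]. Qed.

Lemma gdist_sym x y : gdist x y = gdist y x.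
Proof. by apply/eqP; rewrite eqn_leq; apply/andP; split; apply/gdistP/dist_le_sym/gdistP. Qed.

Lemma gdist_tri y x z : (gdist x z <= gdist x y + gdist y z)%N.
Proof. by apply/gdistP; apply: (@dist_le_trans x y z); apply/gdistP. Qed.

Lemma gdist_adj x y : adj x y -> (gdist x y <= 1)%N.
Proof. by move=> h; apply/gdistP; exists [:: y]; split=> //=; rewrite andbT. Qed.

Lemma gdist0 x y : gdist x y = 0%N -> x = y.
Proof. by move=> /eqP; rewrite -leqn0 => /gdistP [[|a p] [_ ? ?]]. Qed.

Lemma mem_gball (R : realType) x (r : R) y : Defs.ball nb x r y <-> (gdist x y)%:R <= r.
Proof.
split=> [[n [nr /gdistP dn]]|h]; first by apply: le_trans nr; rewrite ler_nat.
by exists (gdist x y); split=> //; apply/gdistP.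
Qed.

Section Volume.
Variables (R : realType) (alpha CL CU : R).
Hypotheses (alpha1 : 1 <= alpha) (CL0 : 0 < CL) (CU0 : 0 < CU)
  (vol : forall (x : V) (r : R), 1 <= r ->
      [/\ finite_set (Defs.ball nb x r),
          CL * r `^ alpha <= vcard (Defs.ball nb x r) &
          vcard (Defs.ball nb x r) <= CU * r `^ alpha]).
Hypothesis infV : infinite_vertices V.

Lemma finite_ball x (r : R) : finite_set (Defs.ball nb x r).
Proof.
apply: (@sub_finite_set _ _ (Defs.ball nb x (Num.max 1 r))).
  by move=> y /mem_gball h; apply/mem_gball; apply: le_trans h _; rewrite le_max lexx orbT.
by have [] := @vol x (Num.max 1 r); rewrite ?le_max ?lexx.
Qed.

Definition ballseq x (r : R) : seq V := fset_set (Defs.ball nb x r).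

Lemma mem_ballseq x r y : (y \in ballseq x r) = ((gdist x y)%:R <= r).
Proof.
rewrite /ballseq in_fset_set; last exact: finite_ball.
by apply/idP/idP; rewrite inE => /mem_gball.
Qed.

Lemma ballseq_uniq x r : uniq (ballseq x r).
Proof. exact: fset_uniq. Qed.

(** Capping [CL] at 1 extends the lower volume bound to radii in [[0, 1)], where a ball still
    contains its centre. *)
Definition cmin : R := Num.min CL 1.

Lemma cmin_gt0 : 0 < cmin.
Proof. by rewrite /cmin lt_min CL0 ltr01. Qed.

Lemma size_ballseq_le x r : (size (ballseq x r))%:R <= CU * (Num.max 1 r) `^ alpha.
Proof.
have [_ _ h] := @vol x (Num.max 1 r) ltac:(by rewrite le_max lexx).
apply: le_trans h; rewrite /vcard ler_nat; apply: uniq_leq_size; first exact: ballseq_uniq.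
by move=> y; rewrite !mem_ballseq => h; apply: le_trans h _; rewrite le_max lexx orbT.
Qed.

Lemma size_ballseq_ge x r : 0 <= r -> cmin * (Num.max 1 r) `^ alpha <= (size (ballseq x r))%:R.
Proof.
move=> r0; have [r1|r1] := leP 1 r.
  have [_ h _] := vol x r1; apply: le_trans h.
  by apply: ler_wpM2r; rewrite ?powR_ge0 // /cmin ge_min lexx.
rewrite powR1 mulr1; apply: (@le_trans _ _ 1); first by rewrite /cmin ge_min lexx orbT.
rewrite ler1n lt0n size_eq0; apply/eqP => h.
by have : x \in ballseq x r by [rewrite mem_ballseq gdistxx]; rewrite h.
Qed.

Lemma deg_le x : (deg nb x)%:R <= CU.
Proof.
have h := size_ballseq_le x 1; rewrite maxxx powR1 mulr1 in h.
apply: le_trans h; rewrite ler_nat; apply: uniq_leq_size; first by case: simple.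
by move=> y xy; rewrite mem_ballseq lern1; apply: gdist_adj.
Qed.

Lemma deg_ge1 x : (1 <= deg nb x)%N.
Proof.
have [y] := infV [:: x]; rewrite inE => yx.
have [n [[|a p] [px py _]]] := conn x y; first by rewrite -py eqxx in yx.
by move: px; rewrite /= /Defs.adj /deg => /andP[+ _]; case: (nb x).
Qed.

(** Double counting of pairs of a ball and a vertex in it: the balls lie in one ball [W] around [y],
    every vertex of [W] belongs to at most [b] of them, and each has volume bounded below. *)
Lemma covering_count (z : nat -> V) (Rr : R) (b : nat) (I : seq nat) y (rho : R) :
  covering nb z Rr b -> 0 < Rr -> 0 <= rho -> uniq I ->
  (forall i, i \in I -> (gdist y (z i))%:R <= rho) ->
  (size I)%:R * (cmin * (Num.max 1 Rr) `^ alpha) <=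
    b%:R * (CU * (rho + Num.max 1 Rr) `^ alpha).
Proof.
move=> [_ cov] Rr0 rho0 uI hI; set W := ballseq y (rho + Num.max 1 Rr).
have m1 : 1 <= Num.max 1 Rr by rewrite le_max lexx.
have s1 : (\sum_(i <- I) size (ballseq (z i) Rr) <= b * size W)%N.
  apply: (@leq_trans (\sum_(i <- I) \sum_(w <- W | w \in ballseq (z i) Rr) 1)%N).
    rewrite big_seq [leqRHS]big_seq; apply: leq_sum => i iI.
    rewrite sum1_count -size_filter; apply: uniq_leq_size; first exact: ballseq_uniq.
    move=> w wi; rewrite mem_filter wi /W mem_ballseq.
    move: wi; rewrite mem_ballseq => wi.
    apply: (@le_trans _ _ ((gdist y (z i))%:R + (gdist (z i) w)%:R)).
      by rewrite -natrD ler_nat gdist_tri.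
    by apply: lerD; rewrite ?hI // (le_trans wi) // le_max lexx orbT.
  rewrite (exchange_big_dep xpredT) //= -sum1_size big_distrr /=.
  apply: leq_sum => w _; rewrite muln1.
  have [fin] := cov w; apply: leq_trans.
  rewrite sum1_count -size_filter; apply: uniq_leq_size; first exact: filter_uniq.
  move=> i; rewrite mem_filter mem_ballseq => /andP[/mem_gball wi _].
  by rewrite in_fset_set // inE.
apply: (@le_trans _ _ (\sum_(i <- I) size (ballseq (z i) Rr))%:R).
  rewrite -sum1_size !natr_sum mulr_suml; apply: ler_sum => i _.
  by rewrite mul1r; apply: size_ballseq_ge; apply: ltW.
apply: (@le_trans _ _ (b * size W)%:R); first by rewrite ler_nat.
rewrite natrM; apply: ler_wpM2l => //.
have := size_ballseq_le y (rho + Num.max 1 Rr); rewrite -/W (max_r _) //; lra.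
Qed.

End Volume.
End GraphMetric.

(** * The quadratic form and the landscape function *)

Lemma sum_seq_supp (R : realType) (V : eqType) (s t : seq V) (F : V -> R) :
  uniq s -> uniq t -> {subset s <= t} -> (forall x, x \notin s -> F x = 0) ->
  \sum_(x <- t) F x = \sum_(x <- s) F x.
Proof.
move=> us ut st F0; rewrite (bigID (mem s)) /= [X in _ + X]big1 ?addr0; last first.
  by move=> x /F0.
rewrite -big_filter; apply: perm_big; apply: uniq_perm; rewrite ?filter_uniq //.
by move=> x; rewrite mem_filter /=; case: (boolP (x \in s)) => // /st ->.
Qed.

Lemma ler_sum_sub (R : realType) (V : eqType) (s t : seq V) (F : V -> R) :
  uniq s -> uniq t -> {subset s <= t} -> (forall x, 0 <= F x) ->
  \sum_(x <- s) F x <= \sum_(x <- t) F x.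
Proof.
move=> us ut st F0; rewrite [leRHS](bigID (mem s)) /=.
have -> : \sum_(x <- t | x \in s) F x = \sum_(x <- s) F x.
  rewrite -big_filter; apply: perm_big; apply: uniq_perm; rewrite ?filter_uniq //.
  by move=> x; rewrite mem_filter /=; case: (boolP (x \in s)) => // /st ->.
by rewrite ler_wpDr // sumr_ge0.
Qed.

Section Operator.
Variables (R : realType) (V : countType) (nb : V -> seq V).
Variables (mu : V -> V -> R) (Vp : V -> R) (A : seq V).
Hypotheses (simple : simple_graph nb) (adm : admissible nb mu Vp A).
Local Notation adj := (adj nb).
Local Notation deg := (deg nb).

Lemma uniqA : uniq A. Proof. by case: adm. Qed.
Lemma sizeA_gt0 : 0 < (size A)%:R :> R.
Proof. by case: adm => _ + _ _; rewrite ltr0n lt0n size_eq0. Qed.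
Lemma muC x y : adj x y -> mu x y = mu y x.
Proof. by case: adm => _ _ h _ /h[]. Qed.
Lemma mu_ge0 x y : adj x y -> 0 <= mu x y.
Proof. by case: adm => _ _ h _ /h[_ /andP[]]. Qed.
Lemma mu_le1 x y : adj x y -> mu x y <= 1.
Proof. by case: adm => _ _ h _ /h[_ /andP[]]. Qed.
Lemma Vp_ge0 x : 0 <= Vp x. Proof. by case: adm. Qed.

(** The action of [H^A] on functions on all of [V], so that cutoffs and Poincare inequalities apply
    without reindexing by ['I_(size A)]. *)
Definition hop (f : V -> R) x : R :=
  ((deg x)%:R + Vp x) * f x - \sum_(y <- A | adj x y) mu x y * f y.

Definition qform (f g : V -> R) : R := \sum_(x <- A) f x * hop g x.

Definition supported (f : V -> R) := forall x, x \notin A -> f x = 0.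

Definition row_of (f : V -> R) : 'rV[R]_(size A) := \row_i f (avert i).

Definition extend (f : 'I_(size A) -> R) (x : V) : R :=
  \sum_i (if avert i == x then f i else 0).

Lemma avert_in (i : 'I_(size A)) : avert i \in A.
Proof. exact: mem_tnth. Qed.

Lemma avert_inj : injective (@avert V A).
Proof.
exact: (elimT (tuple_uniqP (in_tuple A)) uniqA).
Qed.

Lemma avertP x : x \in A -> exists i : 'I_(size A), avert i = x.
Proof. by move=> /(@tnthP _ _ (in_tuple A))[i ->]; exists i. Qed.

Lemma extend_avert f i : extend f (avert i) = f i.
Proof.
rewrite /extend (bigD1 i) //= eqxx big1 ?addr0 // => j ji.
by rewrite (inj_eq avert_inj) (negbTE ji).
Qed.

Lemma extend_supp f : supported (extend f).
Proof.
move=> x xA; apply: big1 => i _; case: eqP => // e.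
by rewrite -e avert_in in xA.
Qed.

Lemma row_of_extend (v : 'rV[R]_(size A)) : row_of (extend (v 0)) = v.
Proof. by apply/rowP => i; rewrite mxE extend_avert. Qed.

Lemma sum_avert (F : V -> R) : \sum_(i < size A) F (avert i) = \sum_(x <- A) F x.
Proof. by rewrite [RHS]big_tnth. Qed.

Lemma Hmat_mul (f : V -> R) i :
  (Hmat nb mu Vp A *m (row_of f)^T) i 0 = hop f (avert i).
Proof.
rewrite mxE; under eq_bigr do rewrite !mxE mulrBl.
rewrite sumrB; congr (_ - _).
  by rewrite (bigD1 i) //= eqxx big1 ?addr0 // => j; rewrite eq_sym => /negbTE->; rewrite mul0r.
rewrite [RHS]big_mkcond -sum_avert; apply: eq_bigr => j _.
by case: ifP => //; rewrite mul0r.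
Qed.

Lemma qform_mx f g :
  (row_of f *m Hmat nb mu Vp A *m (row_of g)^T) 0 0 = qform f g.
Proof.
rewrite -mulmxA mxE /qform -sum_avert; apply: eq_bigr => i _.
by rewrite Hmat_mul mxE.
Qed.

Lemma dot_mx f g : (row_of f *m (row_of g)^T) 0 0 = \sum_(x <- A) f x * g x.
Proof. by rewrite mxE -sum_avert; apply: eq_bigr => i _; rewrite !mxE. Qed.

Lemma Hmat_sym : (Hmat nb mu Vp A)^T = Hmat nb mu Vp A.
Proof.
apply/matrixP => i j; rewrite !mxE eq_sym (adj_sym simple).
case: eqP => [->//|_]; case: ifP => // /muC ->//.
Qed.

Lemma sum_adj_sym (W : seq V) (F : V -> V -> R) :
  \sum_(x <- W) \sum_(y <- W | adj x y) F x y =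
  \sum_(x <- W) \sum_(y <- W | adj x y) F y x.
Proof.
rewrite (exchange_big_dep xpredT) //=; apply: eq_bigr => x _.
by apply: eq_bigl => y; rewrite (adj_sym simple).
Qed.

Lemma sum_adj_deg (W : seq V) x (c : R) : uniq W -> 0 <= c ->
  \sum_(y <- W | adj x y) c <= (deg x)%:R * c.
Proof.
move=> uW c0; rewrite -big_filter big_const_seq count_predT iter_addr_0.
rewrite -[leLHS]mulr_natl; apply: ler_wpM2r => //; rewrite ler_nat.
apply: uniq_leq_size; first exact: filter_uniq.
by move=> y; rewrite mem_filter => /andP[].
Qed.

Definition energy (W : seq V) (f : V -> R) : R :=
  \sum_(y <- W) \sum_(z <- W | adj y z) (f y - f z) ^+ 2.

(** For [0 <= m <= 1] one has [(a - b)^2 <= 2 (a^2 + b^2 - 2 m a b)]. Summed over ordered adjacent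
    pairs this gives at most four times the form without potential, and [Vp >= 0] only increases
    [qform]. *)
Lemma energy_le_qform (W : seq V) f : uniq W -> supported f ->
  energy W f <= 4 * qform f f.
Proof.
(* Passing to a list that contains [A] only adds squares, and lets sums weighted by [f] be cut back
   to [A]. *)
move=> uW0 fA; pose W' := undup (W ++ A).
have uW : uniq W' by exact: undup_uniq.
have AW x : x \in A -> x \in W' by rewrite mem_undup mem_cat => ->; rewrite orbT.
have WW x : x \in W -> x \in W' by rewrite mem_undup mem_cat => ->.
apply: (@le_trans _ _ (energy W' f)).
  apply: (@le_trans _ _ (\sum_(y <- W) \sum_(z <- W' | adj y z) (f y - f z) ^+ 2)).
    apply: ler_sum => y _; rewrite [leLHS]big_mkcond [leRHS]big_mkcond.
    by apply: ler_sum_sub => // x; case: ifP => // _; exact: sqr_ge0.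
  by apply: ler_sum_sub => // x; apply: sumr_ge0 => y _; exact: sqr_ge0.
move: W' uW AW {WW uW0} => {}W uW AW.
apply: (@le_trans _ _ (2 * (\sum_(y <- W) \sum_(z <- W | adj y z) (f y ^+ 2 + f z ^+ 2)
   - 2 * \sum_(y <- W) \sum_(z <- W | adj y z) mu y z * f y * f z))).
  rewrite mulr_sumr -sumrB mulr_sumr; apply: ler_sum => y _.
  rewrite mulr_sumr -sumrB mulr_sumr; apply: ler_sum => z yz.
  have := mu_ge0 yz; have := mu_le1 yz; move: (mu y z) (f y) (f z) => m a b m1 m0.
  (* This expression is the difference of the two sides of the pointwise inequality. *)
  have : 0 <= (1 - m) * (a + b) ^+ 2 + m * (a - b) ^+ 2.
    by rewrite addr_ge0 // mulr_ge0 ?sqr_ge0 // subr_ge0.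
  by rewrite -subr_ge0; congr (_ <= _); ring.
have -> : (4 : R) = 2 * 2 by ring.
rewrite -mulrA ler_pM2l //.
have -> : \sum_(y <- W) \sum_(z <- W | adj y z) (f y ^+ 2 + f z ^+ 2) =
   2 * \sum_(y <- W) \sum_(z <- W | adj y z) f y ^+ 2.
  under eq_bigr do rewrite big_split /=.
  by rewrite big_split /= -(sum_adj_sym _ (fun y z => f y ^+ 2)) mulr2n mulrDl mul1r.
rewrite -mulrBr ler_pM2l //.
have -> : \sum_(y <- W) \sum_(z <- W | adj y z) mu y z * f y * f z =
  \sum_(y <- A) \sum_(z <- A | adj y z) mu y z * f y * f z.
  rewrite (@sum_seq_supp _ _ A W) ?uniqA //; last first.
    by move=> x /fA fx; apply: big1 => z _; rewrite fx mulr0 mul0r.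
  apply: eq_bigr => y _; rewrite [LHS]big_mkcond [RHS]big_mkcond.
  rewrite (@sum_seq_supp _ _ A W) ?uniqA // => x /fA fx; rewrite fx mulr0.
  by case: ifP.
have le1 : \sum_(y <- W) \sum_(z <- W | adj y z) f y ^+ 2
    <= \sum_(y <- A) (deg y)%:R * f y ^+ 2.
  rewrite -(@sum_seq_supp _ _ A W) ?uniqA //; last by move=> x /fA->; rewrite expr0n mulr0.
  by apply: ler_sum => y _; apply: sum_adj_deg; rewrite ?sqr_ge0.
apply: le_trans (lerB le1 (lexx _)) _.
rewrite -sumrB /qform; apply: ler_sum => y _.
rewrite /hop mulrBr mulr_sumr; apply: lerB.
  have := Vp_ge0 y; have := sqr_ge0 (f y); move: (f y) (Vp y) => a v a0 v0.
  have := mulr_ge0 v0 a0; rewrite -subr_ge0 => h; rewrite -subr_ge0.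
  by apply: le_trans h _; rewrite le_eqVlt; apply/orP; left; apply/eqP; ring.
by apply: ler_sum => z _; rewrite mulrCA mulrA.
Qed.

(** The discrete localization identity: the diagonal part commutes with [chi], and symmetrizing
    [chi x ^ 2 - chi x * chi y] in [x] and [y] leaves half of [(chi x - chi y)^2]. It serves both
    for [g = u] and for truncations of [u]. *)
Lemma qform_cutoff (chi g : V -> R) :
  qform (fun x => chi x * g x) (fun x => chi x * g x) =
  \sum_(x <- A) chi x ^+ 2 * g x * hop g x +
  2^-1 * \sum_(x <- A) \sum_(y <- A | adj x y) mu x y * g x * g y * (chi x - chi y) ^+ 2.
Proof.
pose S1 := \sum_(x <- A) \sum_(y <- A | adj x y) mu x y * g x * g y * chi x ^+ 2.
pose S2 := \sum_(x <- A) \sum_(y <- A | adj x y) mu x y * g x * g y * (chi x * chi y).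
have e1 : qform (fun x => chi x * g x) (fun x => chi x * g x) -
    \sum_(x <- A) chi x ^+ 2 * g x * hop g x = S1 - S2.
  rewrite /qform -sumrB -sumrB; apply: eq_bigr => x _.
  rewrite /hop !mulrBr !mulr_sumr.
  have -> : forall a b c d : R, a - b - (c - d) = (a - c) + d - b by move=> *; ring.
  congr (_ - _); last by apply: eq_bigr => y _; ring.
  rewrite (_ : _ - _ = 0) ?add0r; first by apply: eq_bigr => y _; ring.
  by ring.
have e2 : \sum_(x <- A) \sum_(y <- A | adj x y) mu x y * g x * g y * (chi x - chi y) ^+ 2
   = S1 + S1 - 2 * S2.
  have S1E : S1 = \sum_(x <- A) \sum_(y <- A | adj x y) mu x y * g x * g y * chi y ^+ 2.
    rewrite /S1 sum_adj_sym; apply: eq_bigr => x _; apply: eq_bigr => y xy.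
    by rewrite (muC xy); ring.
  rewrite {2}S1E /S1 /S2 mulr_sumr -big_split -sumrB /=.
  apply: eq_bigr => x _; rewrite mulr_sumr -big_split -sumrB /=.
  by apply: eq_bigr => y _; ring.
rewrite e2; move: e1; lra.
Qed.

(** * The landscape function and its maximum principle *)

Section Landscape.
(** Positive definiteness is a hypothesis here because it comes out of the Faber-Krahn inequality;
    [qform_pd] supplies it. *)
Hypothesis pd : forall f, supported f -> qform f f <= 0 -> forall x, f x = 0.

Lemma Hmat_unit : Hmat nb mu Vp A \in unitmx.
Proof.
rewrite -row_free_unit; apply/row_freeP.
have : row_free (Hmat nb mu Vp A).
  rewrite -kermx_eq0; apply/negP => /negP /rowV0Pn [v /sub_kermxP vH /eqP v0].
  apply: v0; rewrite -(row_of_extend v) in vH *.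
  apply/rowP => i; rewrite !mxE; apply: pd; first exact: extend_supp.
  by rewrite -qform_mx vH mul0mx mxE.
by move/row_freeP.
Qed.

Definition lsc : V -> R := extend (fun i => landscape nb mu Vp A i ord0).

Lemma lsc_supp : supported lsc. Proof. exact: extend_supp. Qed.

Lemma hop_lsc x : x \in A -> hop lsc x = 1.
Proof.
move=> /avertP[i <-]; rewrite -Hmat_mul.
have -> : (row_of lsc)^T = landscape nb mu Vp A.
  by apply/colP => j; rewrite 2!mxE /lsc extend_avert.
by rewrite /landscape mulKVmx ?Hmat_unit // mxE.
Qed.

Lemma hop_le0 g x : (forall y, 0 <= g y) -> g x = 0 -> hop g x <= 0.
Proof.
move=> g0 gx; rewrite /hop gx mulr0 sub0r oppr_le0.
by apply: sumr_ge0 => y xy; rewrite mulr_ge0 ?mu_ge0.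
Qed.

(** Where the negative part [m] is positive, the positive part [p] vanishes, so
    [hop m = hop p - 1 < 0]. Hence [qform m m <= 0], and [m = 0] by [pd]. *)
Lemma lsc_ge0 x : 0 <= lsc x.
Proof.
pose m y : R := Num.max (- lsc y) 0; pose p y : R := Num.max (lsc y) 0.
have m0 y : 0 <= m y by rewrite le_max lexx orbT.
have p0 y : 0 <= p y by rewrite le_max lexx orbT.
have pm y : p y = m y + lsc y.
  rewrite /p /m; have [h|h] := leP (lsc y) 0.
    by rewrite max_l ?oppr_ge0 // addNr.
  by rewrite max_r ?add0r // oppr_le0 ltW.
have mp y : m y = 0 \/ p y = 0.
  rewrite /p /m; have [h|h] := leP (lsc y) 0; [by right|left].
  by rewrite max_r // oppr_le0 ltW.
have ms : supported m by move=> y /lsc_supp yA; rewrite /m yA oppr0 maxxx.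
have hopp y : y \in A -> hop p y = hop m y + 1.
  move=> yA; rewrite -(hop_lsc yA) /hop pm mulrDr.
  have -> : \sum_(z <- A | adj y z) mu y z * p z =
    \sum_(z <- A | adj y z) mu y z * m z + \sum_(z <- A | adj y z) mu y z * lsc z.
    by rewrite -big_split; apply: eq_bigr => z _ /=; rewrite pm mulrDr.
  by ring.
have mx0 : m x = 0.
  apply: (pd ms); rewrite /qform big_seq; apply: sumr_le0 => y yA.
  have [->|my] := mp y; first by rewrite mul0r.
  apply: mulr_ge0_le0 => //; have := hopp y yA.
  have := hop_le0 p0 my; lra.
by have := pm x; rewrite mx0 add0r => <-.
Qed.

Lemma lsc_gt0 x : x \in A -> 0 < lsc x.
Proof.
move=> xA; rewrite lt_def lsc_ge0 andbT; apply/eqP => u0.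
by have := hop_le0 lsc_ge0 u0; rewrite hop_lsc // ler10.
Qed.

(** [qform_cutoff] with [chi = f / u] and [g = u]: the first term is the left-hand side since
    [hop u = 1] on [A], and the gradient term is nonnegative. *)
Lemma qform_ge_lsc f : supported f -> \sum_(x <- A) f x ^+ 2 / lsc x <= qform f f.
Proof.
move=> fA; have := qform_cutoff (fun x => f x / lsc x) lsc.
have E : {in A, forall x, f x / lsc x * lsc x = f x}.
  by move=> x xA; rewrite divfK // gt_eqF // lsc_gt0.
have -> : qform (fun x => f x / lsc x * lsc x) (fun x => f x / lsc x * lsc x) = qform f f.
  rewrite /qform; apply: eq_big_seq => x xA; rewrite E //; congr (_ * _).
  rewrite /hop E //; congr (_ - _); rewrite big_seq_cond [RHS]big_seq_cond.
  by apply: eq_bigr => y /andP[yA _]; rewrite E.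
move=> ->; rewrite -[leLHS]addr0; apply: lerD.
  rewrite le_eqVlt; apply/orP; left; apply/eqP; apply: eq_big_seq => x xA.
  rewrite hop_lsc //; have := lsc_gt0 xA => u0.
  by field; rewrite gt_eqF.
rewrite mulr_ge0 //; apply: sumr_ge0 => x _; apply: sumr_ge0 => y xy.
apply: mulr_ge0; last exact: sqr_ge0.
by apply: mulr_ge0; rewrite ?lsc_ge0 // mulr_ge0 ?lsc_ge0 // mu_ge0.
Qed.

Definition lsc_cut (k : R) x : R := Num.max (lsc x - k) 0.

Lemma lsc_cut_ge0 k x : 0 <= lsc_cut k x.
Proof. by rewrite /lsc_cut le_max lexx orbT. Qed.

Lemma lsc_cut_supp k : 0 <= k -> supported (lsc_cut k).
Proof. by move=> k0 x /lsc_supp ux; rewrite /lsc_cut ux sub0r max_r // oppr_le0. Qed.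

(** Truncations remain subsolutions where they are positive: subtracting [k] lowers the diagonal
    term by at least [deg x * k], which outweighs the loss of [mu x y * k] over the neighbours, and
    the positive part only raises neighbouring values. *)
Lemma hop_lsc_cut (k : R) x : 0 <= k -> x \in A -> 0 < lsc_cut k x ->
  hop (lsc_cut k) x <= 1.
Proof.
move=> k0 xA v0; rewrite -(hop_lsc xA) /hop.
have -> : lsc_cut k x = lsc x - k.
  move: v0; rewrite /lsc_cut; have [h|h] := leP (lsc x - k) 0.
    by rewrite ltxx.
  by [].
rewrite mulrBr -addrA -opprD; apply: lerB => //.
have : \sum_(y <- A | adj x y) mu x y * lsc y <=
   \sum_(y <- A | adj x y) mu x y * lsc_cut k y + \sum_(y <- A | adj x y) k.
  rewrite -big_split; apply: ler_sum => y xy /=.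
  have le : lsc y - k <= lsc_cut k y by rewrite /lsc_cut le_max lexx.
  have := ler_wpM2l (mu_ge0 xy) le; have := ler_wpM2r k0 (mu_le1 xy).
  by rewrite mulrBr mul1r; lra.
have := sum_adj_deg x uniqA k0; have := mulr_ge0 (Vp_ge0 x) k0; rewrite mulrDl; lra.
Qed.

End Landscape.
End Operator.

(** * Faber-Krahn inequality and mean value inequality *)

Lemma sum_CauchySchwarz (R : realType) (I : Type) (s : seq I) (a b : I -> R) :
  (\sum_(i <- s) a i * b i) ^+ 2 <=
  (\sum_(i <- s) a i ^+ 2) * (\sum_(i <- s) b i ^+ 2).
Proof.
set S := \sum_(i <- s) a i * b i; set A := \sum_(i <- s) _; set B := \sum_(i <- s) _.
have B0 : 0 <= B by apply: sumr_ge0 => i _; exact: sqr_ge0.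
have A0 : 0 <= A by apply: sumr_ge0 => i _; exact: sqr_ge0.
have q t : 0 <= A - 2 * t * S + t ^+ 2 * B.
  have -> : A - 2 * t * S + t ^+ 2 * B = \sum_(i <- s) (a i - t * b i) ^+ 2.
    rewrite /A /S /B !mulr_sumr -sumrB -big_split /=.
    by apply: eq_bigr => i _; ring.
  by apply: sumr_ge0 => i _; exact: sqr_ge0.
have [B1|B1] := eqVneq B 0.
  rewrite B1 mulr0; have [->|S0] := eqVneq S 0; first by rewrite expr0n.
  (* For [B = 0] the quadratic is affine in [t], and this [t] gives it the value -1. *)
  have := q ((A + 1) / (2 * S)).
  have -> : A - 2 * ((A + 1) / (2 * S)) * S + ((A + 1) / (2 * S)) ^+ 2 * B = -1.
    by rewrite B1; field.
  by lra.
have Bp : 0 < B by rewrite lt_def B1.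
have := q (S / B).
have -> : A - 2 * (S / B) * S + (S / B) ^+ 2 * B = (A * B - S ^+ 2) / B by field.
by rewrite ler_pdivlMr // mul0r subr_ge0.
Qed.

Section FaberKrahn.
Variables (V : countType) (nb : V -> seq V) (R : realType) (alpha CL CU CP lam : R).
Variable b : nat.
Hypotheses (simple : simple_graph nb) (conn : connected_graph nb)
  (infV : infinite_vertices V).
Hypotheses (alpha1 : 1 <= alpha) (CL0 : 0 < CL) (CU0 : 0 < CU)
  (vol : forall (x : V) (r : R), 1 <= r ->
      [/\ finite_set (Defs.ball nb x r),
          CL * r `^ alpha <= vcard (Defs.ball nb x r) &
          vcard (Defs.ball nb x r) <= CU * r `^ alpha]).
Hypotheses (CP0 : 0 < CP) (lam1 : 1 <= lam)
  (poinc : forall (x : V) (r : R), 1 <= r -> forall f : V -> R,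
      let B := ballseq nb x r in
      let fbar := (\sum_(y <- B) f y * (deg nb y)%:R) / (\sum_(y <- B) (deg nb y)%:R) in
      \sum_(y <- B) (f y - fbar) ^+ 2 <=
        CP * r ^+ 2 * energy nb (ballseq nb x (lam * r)) f).
Hypothesis covs : forall Rr : R, 0 < Rr -> exists z : nat -> V, covering nb z Rr b.

Local Notation gdist := (gdist conn).
Local Notation ballseq := (ballseq nb).
Local Notation deg := (deg nb).
Local Notation energy := (energy nb).
Local Notation cmin := (cmin CL).
Let mem_bs x r y : (y \in ballseq x r) = ((gdist x y)%:R <= r) := mem_ballseq conn vol x r y.
Let alpha0 : 0 < alpha := lt_le_trans ltr01 alpha1.
Let cmin0 : 0 < cmin := cmin_gt0 CL0.

(** Bounds, uniformly in [Rr >= 1], the number of dilated balls [B(z_i, lam Rr)] that share a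
    vertex. *)
Definition overlap : R := b%:R * (CU * (lam + 1) `^ alpha) / cmin.

Lemma overlap_ge0 : 0 <= overlap.
Proof. by rewrite /overlap !mulr_ge0 ?powR_ge0 ?invr_ge0 // ?ltW. Qed.

Lemma energy_overlap (z : nat -> V) (Rr : R) (I : seq nat) (f : V -> R) (e : R) :
  covering nb z Rr b -> 1 <= Rr -> uniq I ->
  (forall W, uniq W -> energy W f <= e) ->
  \sum_(i <- I) energy (ballseq (z i) (lam * Rr)) f <= overlap * e.
Proof.
move=> cov R1 uI fe; pose B i := ballseq (z i) (lam * Rr).
have Rr0 : 0 < Rr by apply: lt_le_trans ltr01 R1.
pose W := undup (flatten [seq B i | i <- I]).
have uW : uniq W := undup_uniq _.
have BW i : i \in I -> {subset B i <= W}.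
  move=> iI y yB; rewrite mem_undup; apply/flattenP; exists (B i) => //.
  exact: map_f.
apply: le_trans (ler_wpM2l overlap_ge0 (fe W uW)).
pose G y := \sum_(x <- W | adj nb y x) (f y - f x) ^+ 2.
have G0 y : 0 <= G y by apply: sumr_ge0 => x _; exact: sqr_ge0.
apply: (@le_trans _ _ (\sum_(i <- I) \sum_(y <- W | y \in B i) G y)).
  rewrite big_seq [leRHS]big_seq; apply: ler_sum => i iI.
  rewrite -[leRHS]big_filter /Defs.adj.
  apply: (@le_trans _ _ (\sum_(y <- B i) G y)).
    apply: ler_sum => y _; rewrite /G [leLHS]big_mkcond [leRHS]big_mkcond.
    apply: ler_sum_sub => //; [exact: ballseq_uniq|exact: BW|].
    by move=> x; case: ifP => // _; exact: sqr_ge0.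
  apply: ler_sum_sub => //; [exact: ballseq_uniq|exact: filter_uniq|].
  by move=> y yB; rewrite mem_filter yB (BW i).
rewrite (exchange_big_dep xpredT) //= /energy mulr_sumr.
apply: ler_sum => y _; rewrite -/(G y).
rewrite -big_filter big_const_seq count_predT iter_addr_0 -mulr_natl.
apply: ler_wpM2r => //.
rewrite /overlap ler_pdivlMr // -(@ler_pM2r _ (Rr `^ alpha)) ?powR_gt0 //.
(* [covering_count] with [rho = lam * Rr] bounds the size of [I']; the factor [Rr^alpha] appears on
   both sides and cancels. *)
set I' := [seq i <- I | y \in B i].
have lR0 : 0 <= lam * Rr by rewrite mulr_ge0 ?(le_trans ler01).
have uI' : uniq I' by rewrite filter_uniq.
have hI' i : i \in I' -> (gdist y (z i))%:R <= lam * Rr.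
  by rewrite mem_filter mem_bs gdist_sym // => /andP[].
have := covering_count vol cov Rr0 lR0 uI' hI'.
rewrite (max_r R1) (_ : lam * Rr + Rr = (lam + 1) * Rr); last by ring.
by rewrite powRM ?addr_ge0 ?(le_trans ler01) // !mulrA.
Qed.

Lemma poincare_mean0 x (r : R) (f : V -> R) : 1 <= r ->
  \sum_(y <- ballseq x r) f y * (deg y)%:R = 0 ->
  \sum_(y <- ballseq x r) f y ^+ 2 <= CP * r ^+ 2 * energy (ballseq x (lam * r)) f.
Proof.
move=> r1 f0; apply: le_trans (poinc x r1 f); rewrite /= f0 mul0r.
by under [leRHS]eq_bigr do rewrite subr0.
Qed.

(** Cauchy-Schwarz on the support and [deg <= CU] give [S^2 <= CU^2 N F] for the weighted sum [S]
    and [F = sum f^2]. As [D >= |B|], the mean contributes [|B| (S/D)^2 <= F/4], so [F <= 2 X + F/2]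
    and the last term is absorbed. *)
Lemma poincare_small_support x (r N : R) (f : V -> R) : 1 <= r ->
  (size [seq y <- ballseq x r | f y != 0])%:R <= N ->
  4 * CU ^+ 2 * N <= (size (ballseq x r))%:R ->
  \sum_(y <- ballseq x r) f y ^+ 2 <= 4 * (CP * r ^+ 2 * energy (ballseq x (lam * r)) f).
Proof.
move=> r1 sN NB; have := poinc x r1 f; rewrite /=.
set B := ballseq x r in sN NB *; set X := CP * _ * _.
set S := \sum_(y <- B) f y * (deg y)%:R; set D := \sum_(y <- B) (deg y)%:R; move=> hX.
set F := \sum_(y <- B) f y ^+ 2.
have F0 : 0 <= F by apply: sumr_ge0 => i _; exact: sqr_ge0.
have Bp : 0 < (size B)%:R :> R.
  rewrite ltr0n lt0n size_eq0; apply/eqP => B0.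
  have : x \in B by rewrite mem_bs gdistxx (le_trans ler01).
  by rewrite B0.
have DB : (size B)%:R <= D.
  rewrite /D -sum1_size natr_sum; apply: ler_sum => y _; rewrite ler_nat.
  exact: deg_ge1.
have Dp : 0 < D by apply: lt_le_trans DB.
have SS : S ^+ 2 <= F * (CU ^+ 2 * N).
  have -> : S = \sum_(y <- B) f y * ((f y != 0)%:R * (deg y)%:R).
    by apply: eq_bigr => y _; case: eqP => [->|_] /=; rewrite ?mul0r ?mul1r.
  apply: le_trans (sum_CauchySchwarz _ _ _) _; apply: ler_wpM2l => //.
  apply: (@le_trans _ _ (\sum_(y <- B | f y != 0) CU ^+ 2)).
    rewrite [leRHS]big_mkcond; apply: ler_sum => y _.
    case: (f y != 0); rewrite ?mul1r ?mul0r ?expr0n //=.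
    have dl := deg_le simple conn vol y.
    by rewrite ler_pXn2r ?nnegrE ?ler0n // ltW.
  rewrite -big_filter big_const_seq count_predT iter_addr_0 -mulr_natr.
  by apply: ler_wpM2l; rewrite ?sqr_ge0.
have fb : (size B)%:R * (S / D) ^+ 2 <= F / 4.
  rewrite expr_div_n mulrA ler_pdivrMr ?exprn_gt0 //.
  apply: (@le_trans _ _ ((size B)%:R * (F * (CU ^+ 2 * N)))); first by rewrite ler_pM2l.
  apply: (@le_trans _ _ (F / 4 * (size B)%:R ^+ 2)); last first.
    by apply: ler_wpM2l; rewrite ?divr_ge0 // ler_pXn2r ?nnegrE // ltW.
  have := ler_wpM2l F0 NB; rewrite -(ler_pM2l Bp).
  by rewrite expr2; set n := (size B)%:R; nra.
have : F <= 2 * X + 2 * ((size B)%:R * (S / D) ^+ 2).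
  apply: (@le_trans _ _ (2 * (\sum_(y <- B) (f y - S / D) ^+ 2) + 2 * ((size B)%:R * (S / D) ^+ 2))).
    have -> : (size B)%:R * (S / D) ^+ 2 = \sum_(y <- B) (S / D) ^+ 2.
      by rewrite big_const_seq count_predT iter_addr_0 mulr_natl.
    rewrite !mulr_sumr -big_split /=; apply: ler_sum => y _.
    by have := sqr_ge0 (f y - 2 * (S / D)); rewrite !expr2; nra.
  by rewrite lerD2r ler_pM2l.
by lra.
Qed.

Lemma covering_indices (z : nat -> V) (Rr : R) (s : seq V) :
  covering nb z Rr b ->
  exists I : seq nat, uniq I /\ forall x, x \in s -> exists2 i, i \in I & x \in ballseq (z i) Rr.
Proof.
move=> [cov _]; pose c x := projT1 (cid (cov x)).
exists (undup (map c s)); split; first exact: undup_uniq.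
move=> x xs; exists (c x); first by rewrite mem_undup map_f.
rewrite mem_bs; have : Defs.ball nb (z (c x)) Rr x by rewrite /c; case: cid.
by move/mem_gball; apply.
Qed.

Lemma sum_covered (z : nat -> V) (Rr : R) (I : seq nat) (s : seq V) (F : V -> R) :
  uniq s -> (forall x, 0 <= F x) ->
  (forall x, x \in s -> exists2 i, i \in I & x \in ballseq (z i) Rr) ->
  \sum_(x <- s) F x <= \sum_(i <- I) \sum_(x <- ballseq (z i) Rr) F x.
Proof.
move=> us F0 hs.
apply: (@le_trans _ _ (\sum_(i <- I) \sum_(x <- s | x \in ballseq (z i) Rr) F x)); last first.
  apply: ler_sum => i _; rewrite -big_filter; apply: ler_sum_sub => //.
  - exact: filter_uniq.
  - exact: ballseq_uniq.
  - by move=> x; rewrite mem_filter => /andP[].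
rewrite (exchange_big_dep xpredT) //= big_seq [leRHS]big_seq.
apply: ler_sum => x /hs[i iI xi].
rewrite (big_rem i) //= xi ler_wpDr // sumr_ge0 //.
Qed.

(** [faber_krahn] works at the radius [r] with [r^alpha = FKbase * N]: the summand 1 ensures
    [r >= 1], and [cmin * FKbase >= 4 CU^2] makes the balls as large as [poincare_small_support]
    asks. *)
Definition FKbase : R := 1 + 4 * CU ^+ 2 / cmin.
(** The factor 16 is 4 from [poincare_small_support] times 4 from [energy_le_qform]. *)
Definition FKconst : R := 16 * CP * overlap * FKbase `^ (2 / alpha).

Lemma FKbase_ge1 : 1 <= FKbase.
Proof. by rewrite /FKbase lerDl !mulr_ge0 ?sqr_ge0 ?invr_ge0 // ?ltW. Qed.

Lemma FKconst_ge0 : 0 <= FKconst.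
Proof. by rewrite /FKconst mulr_ge0 ?powR_ge0 // mulr_ge0 ?overlap_ge0 // mulr_ge0 // ltW. Qed.

Section OnDomain.
Variables (mu : V -> V -> R) (Vp : V -> R) (A : seq V).
Hypothesis adm : admissible nb mu Vp A.
Local Notation qform := (qform nb mu Vp A).
Local Notation hop := (hop nb mu Vp A).

Theorem faber_krahn (f : V -> R) (N : R) : supported A f -> 1 <= N ->
  (size [seq x <- A | f x != 0])%:R <= N ->
  \sum_(x <- A) f x ^+ 2 <= FKconst * N `^ (2 / alpha) * qform f f.
Proof.
move=> fA N1 sN; have uA := uniqA adm.
have N0 : 0 <= N by apply: le_trans N1.
have K0 : 0 <= FKbase by apply: le_trans FKbase_ge1.
pose r := (FKbase * N) `^ alpha^-1.
have KN1 : 1 <= FKbase * N by rewrite -[1]mulr1 ler_pM // FKbase_ge1.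
have r1 : 1 <= r.
  have <- : (1 : R) `^ alpha^-1 = 1 by rewrite powR1.
  by apply: ge0_ler_powR; rewrite ?nnegrE ?invr_ge0 ?(ltW alpha0) // (le_trans ler01).
have ra : r `^ alpha = FKbase * N.
  by rewrite -powRrM mulVf ?gt_eqF // powRr1 // (le_trans ler01).
have r2 : r ^+ 2 = FKbase `^ (2 / alpha) * N `^ (2 / alpha).
  by rewrite -powR_mulrn ?(le_trans ler01 r1) // /r -powRrM (mulrC alpha^-1) powRM.
have [z cz] := covs (lt_le_trans ltr01 r1).
have [I [uI hI]] := covering_indices A cz.
apply: le_trans (sum_covered uA (fun x => sqr_ge0 (f x)) hI) _.
apply: (@le_trans _ _ (\sum_(i <- I) 4 * (CP * r ^+ 2 * energy (ballseq (z i) (lam * r)) f))).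
  apply: ler_sum => i _; apply: (@poincare_small_support _ _ N) => //.
    apply: le_trans sN; rewrite ler_nat; apply: uniq_leq_size.
      by rewrite filter_uniq // ballseq_uniq.
    move=> y; rewrite !mem_filter => /andP[fy _]; rewrite fy /=.
    by apply: contraNT fy => /fA ->.
  have := @size_ballseq_ge _ _ conn R alpha CL CU vol (z i) r (le_trans ler01 r1).
  rewrite max_r // ra; apply: le_trans; rewrite mulrA; apply: ler_wpM2r => //.
  have -> : cmin * FKbase = cmin + 4 * CU ^+ 2 by rewrite /FKbase; field; rewrite gt_eqF.
  by rewrite ler_wpDl // ltW.
rewrite -mulr_sumr -mulr_sumr.
have := energy_overlap cz r1 uI (fun W uW => energy_le_qform simple adm uW fA).
move=> h; apply: (@le_trans _ _ (4 * (CP * r ^+ 2) * (overlap * (4 * qform f f)))).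
  rewrite mulrA; apply: ler_wpM2l => //.
  by rewrite mulr_ge0 // mulr_ge0 ?sqr_ge0 // ltW.
by rewrite r2 /FKconst le_eqVlt; apply/orP; left; apply/eqP; ring.
Qed.

(** Faber-Krahn with [N] the size of [A]. It discharges the hypothesis [pd] under which the
    landscape function was studied. *)
Lemma qform_pd f : supported A f -> qform f f <= 0 -> forall x, f x = 0.
Proof.
move=> fA f0 x; have [xA|/fA//] := boolP (x \in A).
pose N : R := (size A)%:R.
have N1 : 1 <= N by have := sizeA_gt0 adm; rewrite ltr0n ler1n.
have := faber_krahn fA N1 _; rewrite ler_nat size_filter count_size => /(_ isT) h.
have : \sum_(x <- A) f x ^+ 2 <= 0.
  by apply: le_trans h _; apply: mulr_ge0_le0 => //; apply: mulr_ge0; [exact: FKconst_ge0|exact: powR_ge0].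
move=> h0; apply/eqP; rewrite -sqrf_eq0 eq_le sqr_ge0 andbT; apply: le_trans h0.
by rewrite (big_rem x) //= ler_wpDr // sumr_ge0 // => y _; exact: sqr_ge0.
Qed.

(** A Caccioppoli estimate. In [qform_cutoff] the first term is at most the sum of [g], as
    [t^2 <= 1] and [hop g <= 1] where [g > 0]; the gradient term is bounded through
    [2 g x g y <= g x ^ 2 + g y ^ 2] and degrees at most [CU]. *)
Lemma qform_radial_cutoff_le (t : nat -> R) (rho : nat) (d : R) (x0 : V) (g : V -> R) :
  (forall x, 0 <= g x) -> (forall x, x \in A -> 0 < g x -> hop g x <= 1) ->
  (forall n, 0 <= t n <= 1) -> (forall n, (rho <= n)%N -> t n = 0) ->
  (forall n, `|t n - t n.+1| <= d) ->
  qform (fun x => t (gdist x0 x) * g x) (fun x => t (gdist x0 x) * g x) <= \sum_(x <- A | (gdist x0 x <= rho)%N) g x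
     + CU * d ^+ 2 * \sum_(x <- A | (gdist x0 x <= rho)%N) g x ^+ 2.
Proof.
move=> g0 hg t01 trho td; rewrite (qform_cutoff simple adm).
have d0 : 0 <= d by apply: le_trans (td 0%N).
apply: lerD.
  rewrite [leRHS]big_mkcond big_seq [leRHS]big_seq; apply: ler_sum => x xA.
  have [gx|gx] := ltP 0 (g x); last first.
    have -> : g x = 0 by apply/eqP; rewrite eq_le gx g0.
    by rewrite mulr0 mul0r; case: ifP.
  case: ifP => [_|/negbT]; last first.
    by rewrite -ltnNge => /ltnW/trho->; rewrite expr0n !mul0r.
  have /andP[t0 t1] := t01 (gdist x0 x).
  apply: (@le_trans _ _ (t (gdist x0 x) ^+ 2 * g x * 1)).
    by apply: ler_wpM2l; rewrite ?mulr_ge0 ?sqr_ge0 ?hg.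
  by rewrite mulr1 ler_piMl // expr_le1.
pose W := [seq x <- A | (gdist x0 x <= rho)%N].
have uW : uniq W by rewrite filter_uniq // (uniqA adm).
have near x y : adj nb x y -> (gdist x0 x <= (gdist x0 y).+1)%N.
  move=> xy; apply: leq_trans (gdist_tri conn y x0 x) _.
  by rewrite -addn1 leq_add2l; apply: gdist_adj; rewrite (adj_sym simple).
have tdiff x y : adj nb x y -> (t (gdist x0 x) - t (gdist x0 y)) ^+ 2 <= d ^+ 2.
  move=> xy; have yx := xy; rewrite (adj_sym simple) in yx.
  rewrite -real_normK ?num_real // ler_pXn2r ?nnegrE //.
  have := near _ _ xy; have := near _ _ yx.
  rewrite leq_eqVlt ltnS => /orP[/eqP->|h1]; first by [].
  rewrite leq_eqVlt ltnS => /orP[/eqP->|h2]; first by rewrite distrC.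
  have -> : gdist x0 x = gdist x0 y by apply/eqP; rewrite eqn_leq h1 h2.
  by rewrite subrr normr0.
(* A vertex farther than [rho] has all its neighbours at distance at least [rho], where [t] already
   vanishes; so only pairs with both ends within [rho] contribute. *)
have tW x y : adj nb x y -> (rho < gdist x0 x)%N ->
    (t (gdist x0 x) - t (gdist x0 y)) ^+ 2 = 0.
  move=> xy rx; rewrite (trho _ (ltnW rx)) trho ?subrr ?expr0n //.
  by rewrite -ltnS; apply: leq_trans rx (near _ _ xy).
rewrite -[\sum_(x <- A | _) g x ^+ 2]big_filter -/W.
have h1 : \sum_(x <- A) \sum_(y <- A | adj nb x y)
    mu x y * g x * g y * (t (gdist x0 x) - t (gdist x0 y)) ^+ 2 <=
  \sum_(x <- W) \sum_(y <- W | adj nb x y) d ^+ 2 * ((g x ^+ 2 + g y ^+ 2) / 2).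
  rewrite /W big_filter [leRHS]big_mkcond; apply: ler_sum => x _.
  case: ifP => [xr|/negbT]; last first.
    rewrite -ltnNge => rx; rewrite big1 // => y xy.
    by rewrite tW // mulr0.
  rewrite big_filter_cond [leRHS]big_mkcond [leLHS]big_mkcond; apply: ler_sum => y _.
  case: (boolP (adj nb x y)) => xy; rewrite ?andbF // andbT.
  case: ifP => [yr|/negbT]; last first.
    rewrite -ltnNge => ry; have yx := xy; rewrite (adj_sym simple) in yx.
    by have := tW _ _ yx ry; rewrite -sqrrN opprB => ->; rewrite mulr0.
  rewrite mulrC; apply: ler_pM; rewrite ?sqr_ge0 ?tdiff //.
    by rewrite !mulr_ge0 // (mu_ge0 adm xy).
  have := mu_le1 adm xy; have := mu_ge0 adm xy => m0 m1.
  apply: (@le_trans _ _ (g x * g y)).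
    by rewrite -mulrA ler_piMl // mulr_ge0.
  by have := sqr_ge0 (g x - g y); rewrite !expr2; nra.
have h2 : \sum_(x <- W) \sum_(y <- W | adj nb x y) d ^+ 2 * ((g x ^+ 2 + g y ^+ 2) / 2)
    <= CU * d ^+ 2 * \sum_(x <- W) g x ^+ 2.
  have -> : \sum_(x <- W) \sum_(y <- W | adj nb x y) d ^+ 2 * ((g x ^+ 2 + g y ^+ 2) / 2)
     = \sum_(x <- W) \sum_(y <- W | adj nb x y) d ^+ 2 * g x ^+ 2.
    pose T := \sum_(x <- W) \sum_(y <- W | adj nb x y) d ^+ 2 * g x ^+ 2.
    transitivity ((T + T) / 2); last by rewrite /T; field.
    have TE : T = \sum_(x <- W) \sum_(y <- W | adj nb x y) d ^+ 2 * g y ^+ 2.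
      by rewrite /T (sum_adj_sym simple).
    rewrite {2}TE /T -big_split /= mulr_suml.
    apply: eq_bigr => x _; rewrite -big_split /= mulr_suml.
    by apply: eq_bigr => y _; field.
  rewrite mulr_sumr; apply: ler_sum => x _.
  apply: le_trans (sum_adj_deg nb x uW _) _; first by rewrite mulr_ge0 ?sqr_ge0.
  by rewrite -mulrA; apply: ler_wpM2r; rewrite ?mulr_ge0 ?sqr_ge0 ?(deg_le simple conn vol).
have h3 := le_trans h1 h2.
have h4 : 0 <= CU * d ^+ 2 * \sum_(x <- W) g x ^+ 2.
  apply: mulr_ge0; first by rewrite mulr_ge0 ?sqr_ge0 // ltW.
  by apply: sumr_ge0 => x _; exact: sqr_ge0.
lra.
Qed.

(** * De Giorgi iteration and the mean value inequality *)

Local Notation u := (lsc nb mu Vp A).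
Local Notation ucut := (lsc_cut nb mu Vp A).
Let pd := qform_pd.

Definition dyadic_cutoff (m n : nat) : R := Num.min 1 (Num.max 0 (2 - n%:R / m%:R)).

Lemma dyadic_cutoffP (m : nat) : (0 < m)%N ->
  [/\ forall n, 0 <= dyadic_cutoff m n <= 1,
      forall n, (m * 2 <= n)%N -> dyadic_cutoff m n = 0,
      forall n, (n <= m)%N -> dyadic_cutoff m n = 1
    & forall n, `|dyadic_cutoff m n - dyadic_cutoff m n.+1| <= m%:R^-1].
Proof.
move=> m0; have m0' : 0 < m%:R :> R by rewrite ltr0n.
rewrite /dyadic_cutoff; split=> [n|n mn|n nm|n].
- by rewrite le_min ler01 le_max lexx ge_min lexx.
- have h : 2 - n%:R / m%:R <= 0 :> R.
    by rewrite subr_le0 ler_pdivlMr // -natrM ler_nat mulnC.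
  by rewrite max_l // min_r.
- have h : 1 <= 2 - n%:R / m%:R :> R.
    have : n%:R / m%:R <= 1 :> R by rewrite ler_pdivrMr // mul1r ler_nat.
    by lra.
  by rewrite max_r ?(le_trans ler01) // min_l.
- have -> : (n.+1)%:R / m%:R = n%:R / m%:R + m%:R^-1 :> R by rewrite -natr1 mulrDl mul1r.
  have : 0 < m%:R^-1 :> R by rewrite invr_gt0.
  have clamp (x d : R) : 0 < d ->
      `|Num.min 1 (Num.max 0 (2 - x)) - Num.min 1 (Num.max 0 (2 - (x + d)))| <= d.
    move=> d0; rewrite ler_norml.
    case: (leP 0 (2 - x)) => h1; case: (leP 0 (2 - (x + d))) => h2;
    case: (leP 1 (2 - x)) => h3; case: (leP 1 (2 - (x + d))) => h4;
    by rewrite ?(min_r ler01); apply/andP; split; lra.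
  exact: clamp.
Qed.

(** Where the higher truncation [w] is positive, the lower one [v] is at least [w + h]. Hence
    [w <= v^2 / h], and by Chebyshev the cut-off [w] has at most [a / h^2] support points;
    Faber-Krahn turns this into the superlinear power of [a] that drives the iteration. *)
Lemma de_giorgi_step (x0 : V) (m : nat) (k h : R) :
  (0 < m)%N -> 0 <= k -> 0 < h ->
  forall a, a = \sum_(x <- A | (gdist x0 x <= m * 2)%N) ucut k x ^+ 2 ->
  \sum_(x <- A | (gdist x0 x <= m)%N) ucut (k + h) x ^+ 2 <=
    FKconst * (a / h ^+ 2) `^ (2 / alpha) * (h^-1 + CU * (m%:R^-1) ^+ 2) * a.
Proof.
move=> m0 k0 h0 a aE; have [t01 tz t1 tl] := dyadic_cutoffP m0.
set w := ucut (k + h); set v := ucut k in aE.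
have kh0 : 0 <= k + h by rewrite addr_ge0 // ltW.
have w0 x : 0 <= w x by exact: lsc_cut_ge0.
have v0 x : 0 <= v x by exact: lsc_cut_ge0.
have wv x : 0 < w x -> w x + h <= v x.
  rewrite /w /v /lsc_cut; case: (leP (u x - (k + h)) 0) => // _; rewrite ?ltxx //.
  by move=> _; rewrite le_max; apply/orP; left; lra.
have w2 x : w x ^+ 2 <= v x ^+ 2.
  have [/wv h1|h1] := ltP 0 (w x).
    by rewrite ler_pXn2r ?nnegrE //; lra.
  have -> : w x = 0 by apply/eqP; rewrite eq_le h1 w0.
  by rewrite expr0n sqr_ge0.
have w1 x : w x <= v x ^+ 2 / h.
  rewrite ler_pdivlMr //; have [wx|h1] := ltP 0 (w x).
    by have := wv x wx; have := v0 x; rewrite expr2; nra.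
  have -> : w x = 0 by apply/eqP; rewrite eq_le h1 w0.
  by rewrite mul0r sqr_ge0.
pose chi x := dyadic_cutoff m (gdist x0 x); pose f x := chi x * w x.
have fA : supported A f.
  by move=> x xA; rewrite /f /w lsc_cut_supp // mulr0.
have a0 : 0 <= a by rewrite aE; apply: sumr_ge0 => x _; exact: sqr_ge0.
have le1 : \sum_(x <- A | (gdist x0 x <= m)%N) w x ^+ 2 <= \sum_(x <- A) f x ^+ 2.
  rewrite big_mkcond; apply: ler_sum => x _; case: ifP => [dx|_]; last exact: sqr_ge0.
  by rewrite /f /chi t1 // mul1r.
have hw x : x \in A -> 0 < w x -> hop w x <= 1 by move=> xA; apply: (hop_lsc_cut adm pd).
have le2 := qform_radial_cutoff_le x0 w0 hw t01 tz tl.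
have le2' : qform f f <= (h^-1 + CU * m%:R^-1 ^+ 2) * a.
  apply: le_trans le2 _; rewrite mulrDl; apply: lerD.
    by rewrite mulrC aE mulr_suml; apply: ler_sum.
  by apply: ler_wpM2l; [rewrite mulr_ge0 ?sqr_ge0 // ltW|rewrite aE; apply: ler_sum].
pose N := a / h ^+ 2.
have sN : (size [seq x <- A | f x != 0])%:R <= N.
  rewrite /N ler_pdivlMr ?exprn_gt0 // -sum1_size natr_sum mulr_suml big_filter.
  rewrite aE big_mkcond [leRHS]big_mkcond; apply: ler_sum => x _.
  case: ifP => [|_]; last by case: ifP => // _; exact: sqr_ge0.
  rewrite /f mulf_eq0 negb_or => /andP[cx wx]; rewrite mul1r.
  case: ifP => [_|/negbT]; last first.
    by rewrite -ltnNge => /ltnW/tz h1; rewrite /chi h1 eqxx in cx.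
  have wx' : 0 < w x by rewrite lt_def wx w0.
  by rewrite ler_pXn2r ?nnegrE ?(ltW h0) //; have := wv x wx'; lra.
(* Faber-Krahn asks for [N >= 1]; otherwise the support has fewer than one element and is empty. *)
have [N1|N1] := leP 1 N.
  apply: le_trans le1 _; apply: le_trans (faber_krahn fA N1 sN) _.
  rewrite -[leRHS]mulrA; apply: ler_wpM2l => //.
  by apply: mulr_ge0; [exact: FKconst_ge0|exact: powR_ge0].
apply: le_trans le1 _.
have -> : \sum_(x <- A) f x ^+ 2 = 0.
  have : (size [seq x <- A | f x != 0])%:R < 1 :> R by apply: le_lt_trans sN N1.
  rewrite ltrn1 ltnS leqn0 size_eq0 => /eqP e; apply: big1_seq => x /= xA.
  have : x \notin [seq x <- A | f x != 0] by rewrite e.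
  by rewrite mem_filter xA andbT negbK => /eqP->; rewrite expr0n.
apply: mulr_ge0 => //; apply: mulr_ge0.
  by apply: mulr_ge0; [exact: FKconst_ge0|exact: powR_ge0].
by rewrite addr_ge0 ?invr_ge0 ?mulr_ge0 ?sqr_ge0 // ltW.
Qed.

(** The second entry makes each step of the iteration contract the square sum by [2^(-alpha) / 4],
    see [DGconstP]; the first leaves room for a strict contradiction at the end. The [+ 1] keeps the
    denominator positive. *)
Definition DGconst : R :=
  Num.min 2^-1 (4^-1 * (2 `^ (- alpha) / (4 * (FKconst * (2 + 4 * CU) + 1))) `^ (alpha / 2)).

Lemma DGconst_gt0 : 0 < DGconst.
Proof.
rewrite /DGconst lt_min invr_gt0 ltr0n /= mulr_gt0 ?invr_gt0 ?powR_gt0 //.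
rewrite divr_gt0 ?powR_gt0 // mulr_gt0 // ltr_wpDl // mulr_ge0 ?FKconst_ge0 //.
by rewrite addr_ge0 // mulr_ge0 // ltW.
Qed.

Lemma DGconstP : FKconst * (4 * DGconst) `^ (2 / alpha) * (2 + 4 * CU) <= 2 `^ (- alpha) / 4.
Proof.
set D := FKconst * (2 + 4 * CU); set q := 2 `^ (- alpha) / (4 * (D + 1)).
have D0 : 0 <= D by rewrite /D mulr_ge0 ?FKconst_ge0 // addr_ge0 // mulr_ge0 // ltW.
have p0 : 0 < 2 `^ (- alpha) :> R by rewrite powR_gt0.
have q0 : 0 <= q by rewrite divr_ge0 ?(ltW p0) // mulr_ge0 // addr_ge0.
have h : (4 * DGconst) `^ (2 / alpha) <= q.
  have e : (q `^ (alpha / 2)) `^ (2 / alpha) = q.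
    rewrite -powRrM (_ : alpha / 2 * (2 / alpha) = 1) ?powRr1 //.
    by field; rewrite gt_eqF.
  rewrite -[leRHS]e; apply: ge0_ler_powR; rewrite ?nnegrE ?powR_ge0 //.
  - by rewrite divr_ge0 // ltW.
  - by rewrite mulr_ge0 // ltW // DGconst_gt0.
  - by rewrite mulrC -ler_pdivlMr // mulrC /DGconst ge_min lexx orbT.
have -> : FKconst * (4 * DGconst) `^ (2 / alpha) * (2 + 4 * CU) =
   D * (4 * DGconst) `^ (2 / alpha) by rewrite /D; ring.
apply: le_trans (ler_wpM2l D0 h) _.
have -> : D * q = (D / (D + 1)) * (2 `^ (- alpha) / 4).
  by rewrite /q; field; rewrite gt_eqF // ltr_wpDl.
apply: ler_piMl; first by rewrite divr_ge0 // ltW.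
by rewrite ler_pdivrMr ?mul1r ?lerDl // ltr_wpDl.
Qed.

(* The square sums over the balls of radius [2 ^ (J - j)], truncated at the
   increasing levels [K (1 - 2 ^ -j)], decay geometrically all the way down to
   the single vertex [x0]. *)
Lemma mean_value_dyadic (x0 : V) (J : nat) (K : R) : x0 \in A ->
  4 ^+ J <= K -> 2 * K <= u x0 ->
  DGconst * K ^+ 2 * (2 ^+ J) `^ alpha <
    \sum_(x <- A | (gdist x0 x <= 2 ^ J)%N) u x ^+ 2.
Proof.
move=> x0A JK Ku; rewrite ltNge; apply/negP => small.
have K0 : 0 < K by apply: lt_le_trans JK; rewrite exprn_gt0.
have u0 x : 0 <= u x by exact: (lsc_ge0 adm pd).
have c0 := DGconst_gt0.
pose k j := K * (1 - 2^-1 ^+ j).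
have k0 j : 0 <= k j.
  by rewrite mulr_ge0 ?(ltW K0) // subr_ge0 exprn_ile1 // ?invr_ge0 // invf_le1 // ler1n.
have claim j : (j <= J)%N ->
  \sum_(x <- A | (gdist x0 x <= 2 ^ (J - j))%N) ucut (k j) x ^+ 2 <=
    DGconst * K ^+ 2 * (2 ^+ (J - j)) `^ alpha * 4^-1 ^+ j.
  elim: j => [|j IH] jJ.
    rewrite subn0 expr0 mulr1; apply: le_trans small.
    apply: ler_sum => x _; rewrite /k expr0 subrr mulr0 /lsc_cut subr0 max_l //.
  have := IH (ltnW jJ); set i := (J - j.+1)%N.
  have Ji : (J - j = i.+1)%N by rewrite /i subnSK.
  rewrite Ji expnSr; set a := \sum_(x <- A | _) _ => ha.
  pose h := K * 2^-1 ^+ j.+1.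
  have h0 : 0 < h by rewrite mulr_gt0 // exprn_gt0 // invr_gt0.
  have kE : k j.+1 = k j + h by rewrite /k /h exprS; field.
  rewrite kE; apply: le_trans (de_giorgi_step (expn_gt0 2 i) (k0 j) h0 (erefl a)) _.
  have a0 : 0 <= a by apply: sumr_ge0 => x _; exact: sqr_ge0.
  have tw (n : nat) : 0 < 2 ^+ n :> R by rewrite exprn_gt0.
  have hh : h ^+ 2 = K ^+ 2 * 4^-1 ^+ j / 4.
    have e4 : (4^-1 : R) = 2^-1 ^+ 2 by rewrite exprVn; congr (_^-1); ring.
    by rewrite /h exprMn e4 -!exprM mulnC [(2 * j.+1)%N]mulnS exprD; field.
  have aN : a / h ^+ 2 <= 4 * DGconst * (2 ^+ i.+1) `^ alpha.
    rewrite ler_pdivrMr ?exprn_gt0 //; apply: le_trans ha _.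
    by rewrite hh le_eqVlt; apply/orP; left; apply/eqP; field.
  have p1 : (a / h ^+ 2) `^ (2 / alpha) <= (4 * DGconst) `^ (2 / alpha) * 4 ^+ i.+1.
    have e : ((2 ^+ i.+1 : R) `^ alpha) `^ (2 / alpha) = 4 ^+ i.+1.
      rewrite -powRrM (_ : alpha * (2 / alpha) = 2%:R); last by field; rewrite gt_eqF.
      rewrite powR_mulrn ?(ltW (tw _)) // -exprM mulnC exprM; congr (_ ^+ _); ring.
    rewrite -e -powRM ?powR_ge0 ?mulr_ge0 ?(ltW c0) //.
    apply: ge0_ler_powR; rewrite ?nnegrE ?divr_ge0 ?sqr_ge0 ?(ltW alpha0) //.
    by rewrite !mulr_ge0 ?powR_ge0 ?(ltW c0).
  (* The Faber-Krahn factor [4^(i+1)] is compensated twice: exactly by the squared slope [4^(-i)] of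
     the cutoff, and by [4^(i+1) <= 2 h], which follows from [4^J <= K]. *)
  have p2 : 4 ^+ i.+1 * (h^-1 + CU * (2 ^ i)%:R^-1 ^+ 2) <= 2 + 4 * CU.
    have e1 : 4 ^+ i.+1 * (CU * (2 ^ i)%:R^-1 ^+ 2) = 4 * CU.
      have -> : (4 : R) ^+ i.+1 = 4 * (2 ^+ i) ^+ 2.
        by rewrite exprS -exprM mulnC exprM; congr (_ * _ ^+ _); ring.
      by rewrite natrX; field; rewrite gt_eqF.
    rewrite mulrDr e1 lerD2r ler_pdivrMr //.
    have e2 : (2 : R) * h = K * 2^-1 ^+ j by rewrite /h exprS; field.
    rewrite e2; apply: (@le_trans _ _ (4 ^+ J * 2^-1 ^+ j)); last first.
      by apply: ler_wpM2r => //; rewrite exprn_ge0 // invr_ge0.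
    rewrite -Ji -(subnK (ltnW jJ)) addnK exprD -mulrA ler_peMr ?exprn_ge0 //.
    by rewrite -exprMn exprn_ege1 // ler_pdivlMr // mul1r ler_nat.
  have big0 : 0 <= h^-1 + CU * (2 ^ i)%:R^-1 ^+ 2.
    by rewrite addr_ge0 ?invr_ge0 ?mulr_ge0 ?sqr_ge0 // ltW.
  apply: (@le_trans _ _ (FKconst * (4 * DGconst) `^ (2 / alpha) * (2 + 4 * CU) * a)).
    apply: ler_wpM2r => //.
    apply: (@le_trans _ _ (FKconst * ((4 * DGconst) `^ (2 / alpha) * 4 ^+ i.+1) * (h^-1 + CU * (2 ^ i)%:R^-1 ^+ 2))).
      apply: ler_wpM2r => //; apply: ler_wpM2l => //; exact: FKconst_ge0.
    rewrite mulrA -[leLHS]mulrA; apply: ler_wpM2l => //.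
    by rewrite mulr_ge0 ?powR_ge0 ?FKconst_ge0.
  apply: le_trans (ler_wpM2r a0 DGconstP) _.
  apply: (@le_trans _ _ (2 `^ (- alpha) / 4 * (DGconst * K ^+ 2 * (2 ^+ i.+1) `^ alpha * 4^-1 ^+ j))).
    by apply: ler_wpM2l ha; rewrite divr_ge0 ?powR_ge0.
  have -> : (2 ^+ i.+1 : R) `^ alpha = 2 `^ alpha * (2 ^+ i) `^ alpha.
    by rewrite exprS powRM // ltW.
  rewrite powRN [4^-1 ^+ j.+1]exprS le_eqVlt; apply/orP; left; apply/eqP.
  by field; rewrite gt_eqF // powR_gt0.
(* At [j = J] the sum is at most [DGconst * K^2 * 4^(-J) < K^2], while the term at [x0] alone is at
   least [(u x0 - K)^2 >= K^2]. *)
have := claim J (leqnn J); rewrite subnn expr0 powR1 mulr1 leNgt => /negP; apply.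
apply: (@lt_le_trans _ _ (K ^+ 2)).
  have i1 : (4^-1 : R) ^+ J <= 1 by rewrite exprn_ile1 // ?invr_ge0 // invf_le1 // ler1n.
  have c1 : DGconst <= 2^-1 by rewrite /DGconst ge_min lexx.
  have i0 : 0 <= (4^-1 : R) ^+ J by rewrite exprn_ge0 // invr_ge0.
  have := exprn_gt0 2 K0; set K2 := K ^+ 2 => K20.
  apply: (@le_lt_trans _ _ (2^-1 * K2)); last by lra.
  rewrite mulrAC; apply: ler_wpM2r; first exact: ltW.
  by apply: le_trans c1; rewrite ler_piMr // ltW.
rewrite (big_rem x0) //= gdistxx /= ler_wpDr //.
  by apply: sumr_ge0 => x _; exact: sqr_ge0.
have kK : k J <= K.
  by rewrite /k ler_piMr ?(ltW K0) // gerBl exprn_ge0 // invr_ge0.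
rewrite ler_pXn2r ?nnegrE ?lsc_cut_ge0 ?(ltW K0) //.
by rewrite /lsc_cut le_max; apply/orP; left; lra.
Qed.

Lemma dyadic_bracket (x : R) : 1 <= x -> exists J : nat, 4 ^+ J <= x < 4 ^+ J.+1.
Proof.
move=> x1.
have [n xn] : exists n : nat, x < 4 ^+ n.
  exists (Num.trunc x).+1; apply: lt_trans (truncnS_gt x) _.
  by rewrite -natrX ltr_nat; exact: ltn_expl.
elim: n xn => [|n IH] xn; first by move: xn; rewrite expr0 ltNge x1.
by have [/IH//|h] := ltP x (4 ^+ n); exists n; rewrite h.
Qed.

(** [4^(-alpha)] pays for replacing [2^J] by [r <= 4 * 2^J], and [1/4] for the choice
    [K = r^2 / 2]. *)
Definition MVconst : R := DGconst * 4 `^ (- alpha) / 4.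

Lemma MVconst_gt0 : 0 < MVconst.
Proof. by rewrite divr_gt0 // mulr_gt0 ?DGconst_gt0 ?powR_gt0. Qed.

Theorem mean_value (x0 : V) (r : R) : x0 \in A -> 0 < r -> r ^+ 2 <= u x0 ->
  MVconst * r ^+ 4 * (Num.max 1 r) `^ alpha <=
    \sum_(x <- A | (gdist x0 x)%:R <= r) u x ^+ 2.
Proof.
move=> x0A r0 ru.
have c0 := DGconst_gt0; have p0 : 0 < 4 `^ alpha :> R by rewrite powR_gt0.
have r4 : r ^+ 4 = (r ^+ 2) ^+ 2 by rewrite -exprM.
have u0 x : 0 <= u x by exact: (lsc_ge0 adm pd).
(* For [r^2 < 2] no [J] satisfies [4^J <= r^2 / 2]; then the term at [x0], at least [r^4], suffices
   since [Num.max 1 r <= 4]. *)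
have [r2|r2] := ltP (r ^+ 2) 2.
  apply: (@le_trans _ _ (u x0 ^+ 2)); last first.
    rewrite (big_rem x0) //= gdistxx (ltW r0) ler_wpDr //.
    by apply: sumr_ge0 => x _; exact: sqr_ge0.
  have rlt : r <= 4 by move: r2; rewrite expr2; nra.
  have m4 : (Num.max 1 r) `^ alpha <= 4 `^ alpha.
    apply: ge0_ler_powR; rewrite ?nnegrE ?(ltW alpha0) // ?le_max ?ler01 //.
    by rewrite ge_max rlt ler1n.
  have c1 : DGconst <= 2^-1 by rewrite /DGconst ge_min lexx.
  apply: (@le_trans _ _ (r ^+ 4)).
    rewrite mulrAC ler_piMl ?exprn_ge0 ?(ltW r0) //.
    apply: (@le_trans _ _ (MVconst * 4 `^ alpha)).
      by apply: ler_wpM2l m4; apply: ltW MVconst_gt0.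
    have -> : MVconst * 4 `^ alpha = DGconst / 4.
      by rewrite /MVconst powRN; field; rewrite gt_eqF.
    by lra.
  by rewrite r4 ler_pXn2r ?nnegrE ?sqr_ge0.
have [J /andP[J1 J2]] := @dyadic_bracket (r ^+ 2 / 2) ltac:(lra).
have := @mean_value_dyadic x0 J (r ^+ 2 / 2) x0A J1 ltac:(lra).
have e4 (n : nat) : (4 : R) ^+ n = (2 ^+ n) ^+ 2.
  by rewrite -exprM mulnC exprM; congr (_ ^+ _); ring.
have t0 : 0 < 2 ^+ J :> R by rewrite exprn_gt0.
have Jr : 2 ^+ J <= r.
  rewrite -(@ler_pXn2r _ 2) ?nnegrE ?(ltW t0) ?(ltW r0) // -e4.
  by apply: le_trans J1 _; have := sqr_ge0 r; lra.
have rJ : r <= 4 * 2 ^+ J.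
  rewrite -(@ler_pXn2r _ 2) ?nnegrE ?(ltW r0) ?mulr_ge0 ?(ltW t0) // exprMn -e4.
  have q0 : 0 < 4 ^+ J :> R by rewrite exprn_gt0.
  move: J2; rewrite [4 ^+ J.+1]exprS (_ : 4 ^+ 2 = 16); last by ring.
  by move: (4 ^+ J) q0 => q q0; lra.
move=> /ltW h; apply: le_trans (le_trans h _); last first.
  rewrite big_mkcond [leRHS]big_mkcond; apply: ler_sum => x _.
  case: ifP => [dx|_]; last by case: ifP => // _; exact: sqr_ge0.
  by rewrite ifT // (le_trans _ Jr) // -natrX ler_nat.
have r1 : 1 <= r by rewrite -(@ler_pXn2r _ 2) ?nnegrE ?(ltW r0) // expr1n; lra.
rewrite (max_r r1).
have ra : r `^ alpha <= 4 `^ alpha * (2 ^+ J) `^ alpha.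
  rewrite -powRM ?(ltW t0) //.
  by apply: ge0_ler_powR; rewrite ?nnegrE ?(ltW alpha0) ?(ltW r0) // mulr_ge0 // ltW.
apply: (@le_trans _ _ (MVconst * r ^+ 4 * (4 `^ alpha * (2 ^+ J) `^ alpha))).
  by apply: ler_wpM2l ra; rewrite mulr_ge0 ?exprn_ge0 ?(ltW r0) // ltW // MVconst_gt0.
rewrite r4 /MVconst powRN le_eqVlt; apply/orP; left; apply/eqP.
by field; rewrite gt_eqF.
Qed.

(** * Counting bad balls *)

Lemma sum_mem_swap (s t : seq V) (F : V -> R) : uniq s -> uniq t ->
  \sum_(x <- s | x \in t) F x = \sum_(x <- t | x \in s) F x.
Proof.
move=> us ut; rewrite -big_filter -[RHS]big_filter; apply: perm_big.
by apply: uniq_perm; rewrite ?filter_uniq // => x; rewrite !mem_filter andbC.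
Qed.

Definition bad_balls (z : nat -> V) (Rr E : R) : seq nat :=
  fset_set [set i : nat | exists k : 'I_(size A),
        Defs.ball nb (z i) Rr (avert k) /\ (landscape nb mu Vp A k ord0)^-1 <= E].

(** [fset_set] describes its argument only when that is finite. Here it is: [A] is finite and each
    vertex lies in finitely many balls. *)
Lemma mem_bad_balls z Rr E i : covering nb z Rr b ->
  (i \in bad_balls z Rr E) <->
  exists x, [/\ x \in A, (gdist (z i) x)%:R <= Rr & (u x)^-1 <= E].
Proof.
move=> [_ cov].
have fin : finite_set [set i : nat | exists k : 'I_(size A),
    Defs.ball nb (z i) Rr (avert k) /\ (landscape nb mu Vp A k ord0)^-1 <= E].
  apply: (@sub_finite_set _ _ (\bigcup_(k in [set: 'I_(size A)])
      [set i | Defs.ball nb (z i) Rr (avert k)])).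
    by move=> j /= [k [jk _]]; exists k.
  apply: bigcup_finite; first exact: finite_finset.
  by move=> k _; have [] := cov (avert k).
rewrite /bad_balls in_fset_set // inE /=; split.
  move=> [k [/(mem_gball conn) h1 h2]]; exists (avert k).
  by rewrite avert_in /lsc (extend_avert adm).
move=> [x [/avertP[k <-] h1 h2]]; exists k; split; first exact/(mem_gball conn).
by move: h2; rewrite /lsc (extend_avert adm).
Qed.

Lemma bad_balls_uniq z Rr E : uniq (bad_balls z Rr E).
Proof. exact: fset_uniq. Qed.

Lemma ballseq_lt1 x (r : R) : 0 <= r -> r < 1 -> perm_eq (ballseq x r) [:: x].
Proof.
move=> r0 r1; apply: uniq_perm; [exact: ballseq_uniq|by []|move=> y].
rewrite mem_bs inE; apply/idP/eqP => [h|->]; last by rewrite gdistxx.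
apply/esym/(@gdist0 _ _ conn)/eqP; rewrite -leqn0 -ltnS -(@ltrn1 R).
exact: le_lt_trans h r1.
Qed.

Lemma sqr_powR_half (e : R) : 0 < e -> (e `^ (- 2^-1)) ^+ 2 = e^-1.
Proof.
move=> e0; rewrite -powR_mulrn ?powR_ge0 // -powRrM mulNr mulVf // powR_inv1 //.
exact: ltW.
Qed.

(** * Upper bound on the eigenvalue count *)

Definition UBconst : R := 2 + 4 * CP * overlap.

Lemma UBconst_gt0 : 0 < UBconst.
Proof.
rewrite /UBconst ltr_pwDl // mulr_ge0 ?overlap_ge0 // mulr_ge0 // ltW //.
Qed.

(** Vertices with [1/u > E] are controlled by [qform_ge_lsc]. The others lie in bad balls, where the
    mean-zero Poincare inequality at radius [E^(-1/2)] applies and [energy_overlap] sums the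
    energies. *)
Lemma mean0_on_bad_balls (z : nat -> V) (E : R) (F : V -> R) : 0 < E ->
  covering nb z (E `^ (- 2^-1)) b -> supported A F ->
  (forall i, i \in bad_balls z (E `^ (- 2^-1)) E ->
    \sum_(y <- ballseq (z i) (E `^ (- 2^-1))) F y * (deg y)%:R = 0) ->
  \sum_(x <- A) F x ^+ 2 <= (1 + 4 * CP * overlap) / E * qform F F.
Proof.
move=> E0; set Rr := E `^ (- 2^-1) => cov FA F0.
have Rr0 : 0 < Rr by rewrite powR_gt0.
have R2 : Rr ^+ 2 = E^-1 by exact: sqr_powR_half.
have Q0 : 0 <= qform F F.
  apply: le_trans (qform_ge_lsc simple adm pd FA); apply: sumr_ge0 => x _.
  by rewrite divr_ge0 ?sqr_ge0 // (lsc_ge0 adm pd).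
rewrite (bigID (fun x => (u x)^-1 <= E)) /=.
have good : \sum_(x <- A | ~~ ((u x)^-1 <= E)) F x ^+ 2 <= E^-1 * qform F F.
  apply: le_trans (ler_wpM2l _ (qform_ge_lsc simple adm pd FA)); last first.
    by rewrite invr_ge0 ltW.
  rewrite big_mkcond mulr_sumr; apply: ler_sum => x _.
  case: ifP => [|_]; last first.
    by rewrite mulr_ge0 ?invr_ge0 ?(ltW E0) // divr_ge0 ?sqr_ge0 // (lsc_ge0 adm pd).
  rewrite -ltNge => /ltW h; rewrite mulrCA -[leLHS]mulr1; apply: ler_wpM2l; rewrite ?sqr_ge0 //.
  by rewrite mulrC ler_pdivlMr // mul1r.
have bad : \sum_(x <- A | (u x)^-1 <= E) F x ^+ 2 <= 4 * CP * overlap / E * qform F F.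
  rewrite -big_filter; set s := [seq x <- A | (u x)^-1 <= E].
  have us : uniq s by rewrite filter_uniq // (uniqA adm).
  have hs x : x \in s -> exists2 i, i \in bad_balls z Rr E & x \in ballseq (z i) Rr.
    rewrite mem_filter => /andP[ux xA]; have [i /(mem_gball conn) hi] := cov.1 x.
    by exists i; [apply/(mem_bad_balls _ _ cov); exists x|rewrite mem_bs].
  apply: le_trans (sum_covered us (fun x => sqr_ge0 (F x)) hs) _.
  have [R1|R1] := leP 1 Rr.
    apply: (@le_trans _ _ (\sum_(i <- bad_balls z Rr E)
        CP * Rr ^+ 2 * energy (ballseq (z i) (lam * Rr)) F)).
      rewrite big_seq [leRHS]big_seq; apply: ler_sum => i iI.
      by apply: poincare_mean0 => //; exact: F0.
    rewrite -mulr_sumr; have := energy_overlap cov R1 (bad_balls_uniq z Rr E)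
      (fun W uW => energy_le_qform simple adm uW FA).
    move=> h; apply: le_trans (ler_wpM2l _ h) _.
      by rewrite mulr_ge0 ?sqr_ge0 // ltW.
    by rewrite R2 le_eqVlt; apply/orP; left; apply/eqP; ring.
  (* For radius below 1 a ball is its centre, so mean zero forces [F] to vanish there because
     degrees are positive. *)
  rewrite big_seq big1 => [|i iI].
    by rewrite mulr_ge0 // divr_ge0 ?(ltW E0) // mulr_ge0 ?overlap_ge0 // mulr_ge0 // ltW.
  have := F0 i iI; rewrite !(perm_big _ (ballseq_lt1 (z i) (ltW Rr0) R1)) /=.
  rewrite !big_seq1 => /eqP; rewrite mulf_eq0 => /orP[/eqP->|]; first by rewrite expr0n.
  by rewrite pnatr_eq0 -leqn0 leqNgt deg_ge1.
by rewrite mulrDl mulrDl addrC mul1r; apply: lerD.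
Qed.

Lemma eig_count_le_bad (z : nat -> V) (E : R) : 0 < E ->
  covering nb z ((UBconst * E) `^ (- 2^-1)) b ->
  (eig_count (Hmat nb mu Vp A) E <=
   size (bad_balls z ((UBconst * E) `^ (- 2^-1)) (UBconst * E)))%N.
Proof.
move=> E0; have C0 := UBconst_gt0; have E'0 : 0 < UBconst * E by rewrite mulr_gt0.
set Rr := _ `^ _ => cov; set J := bad_balls _ _ _.
(* One column per bad ball: [f *m L = 0] says that the extension of [f] by zero has degree-weighted
   mean zero on each of them. *)
pose L : 'M[R]_(size A, size J) := \matrix_(k, j)
  (if avert k \in ballseq (z (tnth (in_tuple J) j)) Rr then (deg (avert k))%:R else 0).
apply: (@eig_count_le _ _ _ _ _ L); first exact: Hmat_sym.
move=> f fL f0; pose F := extend (f 0).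
have fE : f = row_of A F by rewrite /F (row_of_extend adm).
have FA : supported A F by exact: extend_supp.
have uA := uniqA adm.
have F0 i : i \in J -> \sum_(y <- ballseq (z i) Rr) F y * (deg y)%:R = 0.
  move=> /(@tnthP _ _ (in_tuple J))[j ->].
  have := congr1 (fun M : 'rV[R]_(size J) => M 0 j) fL; rewrite !mxE => h.
  rewrite -[RHS]h (bigID (fun y => y \in A)) /= [X in _ + X]big1 ?addr0; last first.
    by move=> y /FA->; rewrite mul0r.
  rewrite (sum_mem_swap _ (ballseq_uniq _ _ _) uA) big_mkcond -sum_avert.
  apply: eq_bigr => k _; rewrite !mxE /F (extend_avert adm).
  by case: ifP => // _; rewrite mulr0.
have := mean0_on_bad_balls E'0 cov FA F0.
have Q0 : 0 < qform F F.
  rewrite ltNge; apply/negP => /(pd FA) Fz; move/eqP: f0; apply.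
  by rewrite fE; apply/rowP => k; rewrite !mxE Fz.
rewrite /quad fE mulmx1 qform_mx dot_mx => h.
apply: (@le_lt_trans _ _ ((1 + 4 * CP * overlap) / UBconst * qform F F)).
  apply: le_trans (ler_wpM2l (ltW E0) h) _.
  by rewrite le_eqVlt; apply/orP; left; apply/eqP; field; rewrite !gt_eqF.
(* [UBconst] exceeds [1 + 4 * CP * overlap] by 1, which makes the inequality strict. *)
rewrite -[ltRHS]mul1r ltr_pM2r // ltr_pdivrMr // mul1r /UBconst; lra.
Qed.

(** * Lower bound on the eigenvalue count *)

Lemma separated_net (D : nat) (X : seq V) : exists Z : seq V,
  [/\ uniq Z, {subset Z <= X},
      forall x y, x \in Z -> y \in Z -> (gdist x y <= D)%N -> x = y
    & forall x, x \in X -> exists2 y, y \in Z & (gdist y x <= D)%N].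
Proof.
elim: X => [|x X [Z [uZ sZ dZ cZ]]]; first by exists [::].
(* Greedy choice: [x] is kept only if it is farther than [D] from all points kept so far. *)
have [/hasP[y yZ yx]|/hasPn far] := boolP (has (fun y => gdist y x <= D)%N Z).
  exists Z; split=> // [w /sZ h|w]; first by rewrite inE h orbT.
  by rewrite inE => /orP[/eqP->|/cZ //]; exists y.
exists (x :: Z); split.
- rewrite /= uZ andbT; apply/negP => /far; by rewrite gdistxx.
- by move=> w; rewrite !inE => /orP[->//|/sZ->]; rewrite orbT.
- move=> v w; rewrite !inE => /orP[/eqP->|vZ] /orP[/eqP->|wZ] // h.
  + by move: (far w wZ); rewrite (gdist_sym simple) h.
  + by move: (far v vZ); rewrite h.
  + exact: dZ.
- move=> w; rewrite inE => /orP[/eqP->|/cZ[y yZ h]].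
    by exists x; rewrite ?mem_head ?gdistxx.
  by exists y; rewrite // inE yZ orbT.
Qed.

Definition tent (k n : nat) : R := Num.max 0 (1 - n%:R / k%:R).

Lemma tentP (k : nat) : (0 < k)%N ->
  [/\ forall n, 0 <= tent k n <= 1, forall n, (k <= n)%N -> tent k n = 0
    & forall n, `|tent k n - tent k n.+1| <= k%:R^-1].
Proof.
move=> k0; have k0' : 0 < k%:R :> R by rewrite ltr0n.
rewrite /tent; split=> [n|n kn|n].
- by rewrite le_max lexx ge_max ler01 gerBl divr_ge0.
- by rewrite max_l // subr_le0 ler_pdivlMr // mul1r ler_nat.
- have -> : (n.+1)%:R / k%:R = n%:R / k%:R + k%:R^-1 :> R by rewrite -natr1 mulrDl mul1r.
  have clamp (x d : R) : 0 < d -> `|Num.max 0 (1 - x) - Num.max 0 (1 - (x + d))| <= d.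
    move=> d0; rewrite ler_norml.
    by case: (leP 0 (1 - x)) => h1; case: (leP 0 (1 - (x + d))) => h2; apply/andP; split; lra.
  by apply: clamp; rewrite invr_gt0.
Qed.

Definition bump (k : nat) (z x : V) : R := tent k (gdist z x) * u x.

(** A bump lives at distance at most [k - 1] from its centre, so equal or adjacent vertices in the
    two supports would put the centres within [2 k - 1]. *)
Lemma qform_bump_sep k z z' : (0 < k)%N -> (2 * k <= gdist z z')%N ->
  qform (bump k z) (bump k z') = 0 /\ \sum_(x <- A) bump k z x * bump k z' x = 0.
Proof.
move=> k0 zz; have [_ tz _] := tentP k0.
have far x y : (gdist x y <= 1)%N -> bump k z x * bump k z' y = 0.
  move=> xy; have [h|h] := leqP k (gdist z x); first by rewrite /bump tz // !mul0r.
  have [h'|h'] := leqP k (gdist z' y); first by rewrite /bump (tz _ h') !mul0r mulr0.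
  suff : (gdist z z' < 2 * k)%N by rewrite ltnNge zz.
  apply: leq_ltn_trans (gdist_tri conn x z z') _.
  apply: (@leq_ltn_trans (gdist z x + (gdist x y + gdist y z'))).
    by rewrite leq_add2l gdist_tri.
  rewrite (gdist_sym simple conn y z'); lia.
split; apply: big1 => x _; last by rewrite far // gdistxx.
rewrite /hop mulrBr mulrCA far ?gdistxx // mulr0 sub0r mulr_sumr big1 ?oppr0 // => y xy.
by rewrite mulrCA far ?mulr0 // gdist_adj.
Qed.

(** [CU * (1 + CU)] comes from the energy of a bump and [4 / MVconst] from its mass; [2^alpha]
    allows [bump_energy] to speak of [k / 2], which is comparable to the radius without loss. *)
Definition LBconst : R := 4 * CU * (1 + CU) * 2 `^ alpha / MVconst.

Lemma LBconst_gt0 : 0 < LBconst.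
Proof. by rewrite divr_gt0 ?MVconst_gt0 // !mulr_gt0 ?powR_gt0 // addr_gt0. Qed.

(** Mass: the tent is at least [1/2] on [B(z, r)] as [2 r <= k], and [mean_value] bounds [u] there
    from below in square sum. Energy: by [qform_radial_cutoff_le] and [u <= T <= k^2], it is at most
    [CU (1 + CU) k^alpha T]. The last hypothesis compares the two. *)
Lemma bump_energy (k : nat) (z : V) (r E T : R) : z \in A ->
  0 < r -> 0 <= E -> 2 * r <= k%:R -> (0 < k)%N -> 0 <= T -> T <= k%:R ^+ 2 ->
  r ^+ 2 <= u z -> (forall x, x \in A -> (gdist z x <= k)%N -> u x <= T) ->
  LBconst * (k%:R / 2) `^ alpha * T <= E * r ^+ 4 * (Num.max 1 r) `^ alpha ->
  0 < \sum_(x <- A) bump k z x ^+ 2 /\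
  qform (bump k z) (bump k z) <= E * \sum_(x <- A) bump k z x ^+ 2.
Proof.
move=> zA r0 E0 rk k0 T0 Tk rz uT hE.
have [t01 tz tl] := tentP k0.
have k0' : 0 < k%:R :> R by rewrite ltr0n.
have u0 x : 0 <= u x by exact: (lsc_ge0 adm pd).
have mv := mean_value zA r0 rz.
have mass : MVconst * r ^+ 4 * Num.max 1 r `^ alpha / 4 <= \sum_(x <- A) bump k z x ^+ 2.
  apply: (@le_trans _ _ ((\sum_(x <- A | (gdist z x)%:R <= r) u x ^+ 2) / 4)).
    by rewrite ler_pM2r ?invr_gt0.
  rewrite mulr_suml big_mkcond; apply: ler_sum => x _.
  case: ifP => [zx|_]; last exact: sqr_ge0.
  have t2 : 2^-1 <= tent k (gdist z x).
    rewrite /tent le_max; apply/orP; right.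
    have : (gdist z x)%:R / k%:R <= 2^-1 :> R by rewrite ler_pdivrMr //; lra.
    by lra.
  rewrite /bump exprMn mulrC; apply: ler_wpM2r; first exact: sqr_ge0.
  rewrite (_ : 4^-1 = 2^-1 ^+ 2); last by rewrite exprVn; congr (_^-1); ring.
  by rewrite ler_pXn2r ?nnegrE ?invr_ge0 //; case/andP: (t01 (gdist z x)).
have m0 : 0 < Num.max 1 r by rewrite lt_max ltr01.
have M0 := MVconst_gt0.
have mpos : 0 < MVconst * r ^+ 4 * Num.max 1 r `^ alpha / 4.
  by rewrite divr_gt0 // mulr_gt0 ?powR_gt0 // mulr_gt0 // exprn_gt0.
split; first exact: lt_le_trans mass.
apply: le_trans (ler_wpM2l E0 mass).
have hu x : x \in A -> 0 < u x -> hop u x <= 1 by move=> xA _; rewrite (hop_lsc adm pd).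
apply: le_trans (qform_radial_cutoff_le z u0 hu t01 tz tl) _.
have cnt (c : R) : 0 <= c -> \sum_(x <- A | (gdist z x <= k)%N) c <= CU * k%:R `^ alpha * c.
  move=> c0; rewrite -big_filter big_const_seq count_predT iter_addr_0 -[leLHS]mulr_natl.
  apply: ler_wpM2r => //.
  have := size_ballseq_le conn vol z k%:R; rewrite (max_r (_ : 1 <= k%:R :> R)) ?ler1n //.
  apply: le_trans; rewrite ler_nat; apply: uniq_leq_size.
    by rewrite filter_uniq // (uniqA adm).
  by move=> x; rewrite mem_filter mem_bs ler_nat => /andP[].
have s1 : \sum_(x <- A | (gdist z x <= k)%N) u x <= CU * k%:R `^ alpha * T.
  apply: le_trans (cnt T T0); rewrite big_seq_cond [leRHS]big_seq_cond.
  by apply: ler_sum => x /andP[xA zx]; exact: uT.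
have s2 : \sum_(x <- A | (gdist z x <= k)%N) u x ^+ 2 <= CU * k%:R `^ alpha * T ^+ 2.
  apply: le_trans (cnt (T ^+ 2) (sqr_ge0 T)); rewrite big_seq_cond [leRHS]big_seq_cond.
  by apply: ler_sum => x /andP[xA zx]; rewrite ler_pXn2r ?nnegrE ?uT.
have P0 : 0 <= CU * k%:R `^ alpha by rewrite mulr_ge0 ?powR_ge0 // ltW.
apply: (@le_trans _ _ (CU * (1 + CU) * k%:R `^ alpha * T)).
  have -> : CU * (1 + CU) * k%:R `^ alpha * T =
    CU * k%:R `^ alpha * T + CU * (CU * k%:R `^ alpha * T) by ring.
  apply: lerD s1 _; rewrite -mulrA ler_pM2l //.
  apply: le_trans (ler_wpM2l _ s2) _; first exact: sqr_ge0.
  rewrite mulrCA; apply: ler_wpM2l => //.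
  rewrite exprVn mulrC ler_pdivrMr ?exprn_gt0 // expr2.
  by apply: ler_wpM2l.
have k2 : k%:R `^ alpha = 2 `^ alpha * (k%:R / 2) `^ alpha.
  by rewrite -powRM ?divr_ge0 // mulrCA divff // mulr1.
have q0 : 0 < 4 / MVconst by exact: divr_gt0.
rewrite k2 -(ler_pM2l q0).
have -> : 4 / MVconst * (CU * (1 + CU) * (2 `^ alpha * (k%:R / 2) `^ alpha) * T) =
  LBconst * (k%:R / 2) `^ alpha * T by rewrite /LBconst; field; rewrite gt_eqF.
by apply: le_trans hE _; rewrite le_eqVlt; apply/orP; left; apply/eqP; field; rewrite gt_eqF.
Qed.

(** Each bad ball has its centre within [D + Rr] of some net point, and [covering_count] bounds the
    number of such balls for each point. *)
Lemma bad_balls_le_net (z : nat -> V) (Rr E : R) (D : nat) (Z : seq V) :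
  covering nb z Rr b -> 0 < Rr ->
  (forall x, x \in A -> (u x)^-1 <= E -> exists2 y, y \in Z & (gdist y x <= D)%N) ->
  (size (bad_balls z Rr E))%:R * (cmin * (Num.max 1 Rr) `^ alpha) <=
  (size Z)%:R * (b%:R * (CU * (D%:R + Rr + Num.max 1 Rr) `^ alpha)).
Proof.
move=> cov Rr0 net; set J := bad_balls _ _ _.
pose I y := [seq i <- J | (gdist y (z i))%:R <= D%:R + Rr].
have JI : (size J <= \sum_(y <- Z) size (I y))%N.
  have -> : (\sum_(y <- Z) size (I y) =
      \sum_(y <- Z) \sum_(i <- J | ((gdist y (z i))%:R <= D%:R + Rr)%R) 1)%N.
    by apply: eq_bigr => y _; rewrite sum1_count size_filter.
  rewrite (exchange_big_dep xpredT) //= -sum1_size big_seq [leqRHS]big_seq.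
  apply: leq_sum => i /(mem_bad_balls _ _ cov)[x [xA zx ux]].
  have [y yZ yx] := net x xA ux.
  rewrite (big_rem y) //= ifT //.
  apply: (@le_trans _ _ ((gdist y x)%:R + (gdist x (z i))%:R)).
    by rewrite -natrD ler_nat gdist_tri.
  by apply: lerD; rewrite ?ler_nat // (gdist_sym simple).
apply: (@le_trans _ _ (\sum_(y <- Z) (size (I y))%:R * (cmin * (Num.max 1 Rr) `^ alpha))).
  rewrite -mulr_suml -natr_sum; apply: ler_wpM2r; last by rewrite ler_nat.
  by rewrite mulr_ge0 ?powR_ge0 // ltW.
rewrite -sum1_size natr_sum mulr_suml; apply: ler_sum => y _; rewrite mul1r.
apply: (covering_count (y := y) vol cov Rr0); first by rewrite addr_ge0 // ltW.
  by rewrite filter_uniq // bad_balls_uniq.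
by move=> i; rewrite mem_filter => /andP[].
Qed.

(** Each net point is sent to a bad ball covering its nearby vertex [y]. Two points with the same
    ball are joined through [y], the centre and [y'] by four distances of at most [k], hence
    coincide. *)
Lemma net_le_bad_balls (z : nat -> V) (Rr E : R) (k : nat) (Z : seq V) :
  covering nb z Rr b -> Rr <= k%:R -> uniq Z ->
  (forall x y, x \in Z -> y \in Z -> (gdist x y <= 4 * k)%N -> x = y) ->
  (forall x, x \in Z -> exists y, [/\ y \in A, (gdist x y <= k)%N & (u y)^-1 <= E]) ->
  (size Z <= size (bad_balls z Rr E))%N.
Proof.
move=> cov Rk uZ dZ hZ.
have ex x : exists i : nat, x \in Z ->
    i \in bad_balls z Rr E /\ exists2 y, (gdist x y <= k)%N & (gdist (z i) y <= k)%N.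
  have [xZ|] := boolP (x \in Z); last by exists 0%N.
  have [y [yA xy uy]] := hZ x xZ; have [i /(mem_gball conn) iy] := cov.1 y.
  exists i => _; split; first by apply/(mem_bad_balls _ _ cov); exists y.
  by exists y => //; rewrite -(ler_nat R); apply: le_trans iy Rk.
have [g hg] := choice ex.
rewrite -(size_map g); apply: uniq_leq_size; last first.
  by move=> i /mapP[x xZ ->]; have [] := hg x xZ.
rewrite map_inj_in_uniq // => x x' xZ x'Z gx.
have [_ [y xy zy]] := hg x xZ; have [_ [y' xy' zy']] := hg x' x'Z.
apply: dZ => //; rewrite -gx in zy'.
have t1 := gdist_tri conn y x x'; have t2 := gdist_tri conn (z (g x)) y x'.
have t3 := gdist_tri conn y' (z (g x)) x'.
rewrite (gdist_sym simple conn y (z (g x))) in t2.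
rewrite (gdist_sym simple conn y' x') in t3.
lia.
Qed.

(** The 10 arises from [4 k + r3 + m3 <= 8 m4 + m4 + m4], where [m3] and [m4] are the radii capped
    below by 1; [b.+1] keeps the denominator positive. *)
Definition Netconst : R := cmin / (b.+1%:R * CU * 10 `^ alpha).

Lemma Netconst_gt0 : 0 < Netconst.
Proof. by rewrite divr_gt0 // !mulr_gt0 ?powR_gt0. Qed.

(** [rho] compares the two radii after capping them below by 1, and is the only source of a volume
    loss. The last hypothesis is the Rayleigh condition of [bump_energy] for [r = E3^(-1/2)] and
    [T = 1/E4]. *)
Lemma eig_count_ge_bad (z3 z4 : nat -> V) (E E3 E4 rho : R) :
  0 < E -> 0 < E3 -> 0 < E4 -> 1 <= rho ->
  covering nb z3 (E3 `^ (- 2^-1)) b -> covering nb z4 (E4 `^ (- 2^-1)) b ->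
  2 * E3 `^ (- 2^-1) <= E4 `^ (- 2^-1) ->
  Num.max 1 (E4 `^ (- 2^-1)) <= rho * Num.max 1 (E3 `^ (- 2^-1)) ->
  LBconst * rho `^ alpha * E4^-1 <= E * E3 ^- 2 ->
  Netconst * rho `^ (- alpha) * (size (bad_balls z3 (E3 `^ (- 2^-1)) E3))%:R
    - (size (bad_balls z4 (E4 `^ (- 2^-1)) E4))%:R
  <= (eig_count (Hmat nb mu Vp A) E)%:R.
Proof.
move=> E0 E30 E40 rho1.
have r32 := sqr_powR_half E30; have r42 := sqr_powR_half E40.
have r30 : 0 < E3 `^ (- 2^-1) by rewrite powR_gt0.
have r40 : 0 < E4 `^ (- 2^-1) by rewrite powR_gt0.
move: (E3 `^ _) (E4 `^ _) r32 r42 r30 r40 => r3 r4 r32 r42 r30 r40 cov3 cov4 r34 mm hE.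
(* An integer radius with [k >= 1] and [r4 <= k <= 2 m4], also when [r4 < 1]. *)
pose k := (Num.trunc r4).+1.
have /andP[k1 k2] := truncn_itv (ltW r40).
have r4k : r4 <= k%:R by exact: ltW.
have kS : k%:R = (Num.trunc r4)%:R + 1 :> R by rewrite /k -natr1.
set m3 := Num.max 1 r3 in mm *; set m4 := Num.max 1 r4 in mm *.
have m41 : 1 <= m4 by rewrite le_max lexx.
have r4m : r4 <= m4 by rewrite le_max lexx orbT.
have m30 : 0 < m3 by rewrite lt_max ltr01.
have km : k%:R <= 2 * m4 by rewrite kS; lra.
pose X := [seq x <- A | (u x)^-1 <= E3].
have [Z [uZ sZ dZ cZ]] := separated_net (4 * k) X.
have ZA x : x \in Z -> x \in A by move=> /sZ; rewrite mem_filter => /andP[].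
have uE (e : R) x : 0 < e -> x \in A -> ((u x)^-1 <= e) = (e^-1 <= u x).
  move=> e0 xA; have ux := lsc_gt0 adm pd xA.
  by rewrite -[in RHS](invrK (u x)) lef_pV2 // posrE ?invr_gt0.
(* Net points with a vertex of [1/u <= E4] within [k] are charged to distinct bad balls at level
   [E4]; around the others [u <= 1/E4], so their bumps are valid test functions. *)
pose isbad x := has (fun y => (gdist x y <= k)%N && ((u y)^-1 <= E4)) A.
pose Zb := [seq x <- Z | isbad x]; pose Zg := [seq x <- Z | ~~ isbad x].
have sZZ : (size Z = size Zb + size Zg)%N by rewrite !size_filter count_predC.
have hb : (size Zb <= size (bad_balls z4 r4 E4))%N.
  apply: (net_le_bad_balls cov4 r4k); first exact: filter_uniq.
    by move=> x y; rewrite !mem_filter => /andP[_ xZ] /andP[_ yZ]; exact: dZ.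
  move=> x; rewrite mem_filter => /andP[/hasP[y yA /andP[xy uy]] _].
  by exists y.
have hg : (size Zg <= eig_count (Hmat nb mu Vp A) E)%N.
  pose zj (j : 'I_(size Zg)) := tnth (in_tuple Zg) j.
  have zjP j : [/\ zj j \in Z, ~~ isbad (zj j) & zj j \in A].
    have := mem_tnth j (in_tuple Zg); rewrite -/(zj j) mem_filter => /andP[h1 h2].
    by split=> //; exact: ZA.
  pose W : 'M[R]_(size Zg, size A) := \matrix_(j, i) bump k (zj j) (avert i).
  have rowW j : row j W = row_of A (bump k (zj j)).
    by apply/rowP => i; rewrite !mxE.
  have gram (K : 'M[R]_(size A)) i j :
      quad K W i j = (row i W *m K *m (row j W)^T) 0 0.
    rewrite /quad -row_mul !mxE; apply: eq_bigr => l _; rewrite !mxE //.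
  have sep i j : i != j -> (2 * k <= gdist (zj i) (zj j))%N.
    move=> ij; have [zi _ _] := zjP i; have [zj' _ _] := zjP j.
    apply: (@leq_trans (4 * k)); first by rewrite leq_mul2r orbT.
    apply: ltnW; rewrite ltnNge; apply: contraNN ij => /(dZ _ _ zi zj') h.
    apply/eqP/(elimT (tuple_uniqP (in_tuple Zg))) => //; exact: filter_uniq.
  pose a : 'rV[R]_(size Zg) := \row_j qform (bump k (zj j)) (bump k (zj j)).
  pose d : 'rV[R]_(size Zg) := \row_j \sum_(x <- A) bump k (zj j) x ^+ 2.
  have main j : 0 < d 0 j /\ a 0 j <= E * d 0 j.
    rewrite !mxE; have [zZ zb zA] := zjP j.
    apply: (@bump_energy k (zj j) r3 E E4^-1 zA r30 (ltW E0)) => //.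
    - by apply: le_trans r34 _.
    - by rewrite invr_ge0 ltW.
    - by rewrite -r42 ler_pXn2r ?nnegrE // ltW.
    - have := sZ _ zZ; rewrite mem_filter => /andP[+ _].
      by rewrite uE // r32.
    - move=> x xA zx; move/hasPn: zb => /(_ x xA); rewrite zx /= uE // -ltNge.
      exact: ltW.
    have e34 : r3 ^+ 4 = E3 ^- 2 by rewrite (exprM r3 2 2) r32 exprVn.
    have kh : (k%:R / 2) `^ alpha <= rho `^ alpha * m3 `^ alpha.
      rewrite -powRM ?(ltW m30) ?(le_trans ler01 rho1) //.
      apply: ge0_ler_powR; rewrite ?nnegrE ?divr_ge0 ?(ltW alpha0) //.
        by rewrite mulr_ge0 ?(ltW m30) ?(le_trans ler01 rho1).
      by apply: le_trans mm; rewrite ler_pdivrMr // mulrC.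
    apply: (@le_trans _ _ (LBconst * rho `^ alpha * E4^-1 * m3 `^ alpha)).
      have -> : LBconst * rho `^ alpha * E4^-1 * m3 `^ alpha =
        LBconst * (rho `^ alpha * m3 `^ alpha) * E4^-1 by ring.
      apply: ler_wpM2r; first by rewrite invr_ge0 ltW.
      by apply: ler_wpM2l kh; rewrite ltW // LBconst_gt0.
    by rewrite e34; apply: ler_wpM2r; rewrite ?powR_ge0.
  apply: (@eig_count_ge _ _ _ _ _ W a d); first exact: Hmat_sym.
  - apply/matrixP => i j; rewrite gram !rowW qform_mx !mxE.
    have [->|ij] := eqVneq i j; first by rewrite mulr1n.
    by rewrite mulr0n (qform_bump_sep _ (sep _ _ ij)).1.
  - apply/matrixP => i j; rewrite gram !rowW mulmx1 dot_mx !mxE.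
    have [->|ij] := eqVneq i j; first by rewrite mulr1n.
    by rewrite mulr0n (qform_bump_sep _ (sep _ _ ij)).2.
  - by move=> j; case: (main j).
  - by move=> j; case: (main j).
have hn : Netconst * rho `^ (- alpha) * (size (bad_balls z3 r3 E3))%:R <= (size Z)%:R.
  have net x : x \in A -> (u x)^-1 <= E3 -> exists2 y, y \in Z & (gdist y x <= 4 * k)%N.
    by move=> xA ux; apply: cZ; rewrite mem_filter ux.
  have := bad_balls_le_net cov3 r30 net; rewrite -/m3.
  set S3 := (size (bad_balls _ _ _))%:R; set SZ := (size Z)%:R => h.
  have m3a : 0 < m3 `^ alpha by rewrite powR_gt0.
  have SZ0 : 0 <= SZ by rewrite ler0n.
  have bp : 0 < b.+1%:R * CU * 10 `^ alpha by rewrite !mulr_gt0 ?powR_gt0.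
  have rp : 0 < rho `^ alpha by rewrite powR_gt0 // (lt_le_trans ltr01).
  have h2 : S3 * (cmin * m3 `^ alpha) <=
      SZ * (b.+1%:R * CU * 10 `^ alpha * (rho `^ alpha * m3 `^ alpha)).
    apply: le_trans h _; apply: ler_wpM2l => //.
    have -> : b.+1%:R * CU * 10 `^ alpha * (rho `^ alpha * m3 `^ alpha) =
       b.+1%:R * (CU * (10 `^ alpha * (rho `^ alpha * m3 `^ alpha))) by ring.
    apply: ler_pM; rewrite ?ler_nat //; first by rewrite mulr_ge0 ?powR_ge0 // ltW.
    rewrite ler_pM2l // -!powRM ?mulr_ge0 ?(ltW m30) ?(le_trans ler01 rho1) //.
    have m34 : m3 <= m4.
      rewrite ge_max m41 /=; apply: le_trans r4m; apply: le_trans r34.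
      by rewrite ler_peMl ?(ltW r30) // ler1n.
    apply: ge0_ler_powR; rewrite ?nnegrE ?addr_ge0 ?mulr_ge0 ?(ltW alpha0) ?(ltW m30) ?(ltW r30) ?(le_trans ler01 rho1) //.
    apply: (@le_trans _ _ (10 * m4)); last by rewrite ler_pM2l.
    have r3m : r3 <= m3 by rewrite le_max lexx orbT.
    by rewrite natrM; lra.
  rewrite /Netconst powRN.
  have -> : cmin / (b.+1%:R * CU * 10 `^ alpha) / rho `^ alpha * S3 =
     (S3 * (cmin * m3 `^ alpha)) / (b.+1%:R * CU * 10 `^ alpha * (rho `^ alpha * m3 `^ alpha)).
    have [n1 n2 n3 n4] : [/\ b.+1%:R != 0 :> R, CU != 0, 10 `^ alpha != 0 :> R & rho `^ alpha != 0].
      by rewrite !gt_eqF // powR_gt0.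
    have n5 : m3 `^ alpha != 0 by rewrite gt_eqF.
    by move: (b.+1%:R : R) n1 => b1 n1; field; do !(apply/andP; split).
  by rewrite ler_pdivrMr // mulr_gt0 // mulr_gt0.
apply: (@le_trans _ _ (size Zg)%:R); last by rewrite ler_nat.
rewrite lerBlDr; apply: le_trans hn _.
by rewrite sZZ natrD addrC lerD2l ler_nat.
Qed.

End OnDomain.
End FaberKrahn.

(** * Choice of the constants *)

Unset Implicit Arguments.

Theorem theorem1p1 (R : realType) (V : countType) (nb : V -> seq V) (alpha : R) :
  simple_graph nb -> connected_graph nb -> infinite_vertices V ->
  1 <= alpha -> volume_control nb alpha -> @weak_poincare V nb R ->
  forall b : nat,
  (forall Rr : R, 0 < Rr -> exists z : nat -> V, covering nb z Rr b) ->
  (* (i) upper bound *)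
  (exists C : R, 0 < C /\
     forall (A : seq V) (mu : V -> V -> R) (Vp : V -> R) (Pc : R -> nat -> V),
       admissible nb mu Vp A ->
       (forall Rr : R, 0 < Rr -> covering nb (Pc Rr) Rr b) ->
       forall E : R, 0 < E -> IDS nb mu Vp A E <= Nu nb mu Vp A Pc (C * E))
  /\
  (* (ii) lower bound *)
  (exists c1 c2 c3 c4 c1' c2' c3' c4' cs : R,
     [/\ 0 < c1, 0 < c2, 0 < c3, 0 < c4 &
      [/\ 0 < c1', 0 < c2', 0 < c3', 0 < c4' & 0 < cs]] /\
     forall (A : seq V) (mu : V -> V -> R) (Vp : V -> R) (Pc : R -> nat -> V),
       admissible nb mu Vp A ->
       (forall Rr : R, 0 < Rr -> covering nb (Pc Rr) Rr b) ->
       forall kappa : R, 0 < kappa -> kappa < 4^-1 ->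
       forall E : R, 0 < E ->
         (E <= cs * kappa ^- 4 ->
            IDS nb mu Vp A E >=
              c1 * kappa `^ alpha * Nu nb mu Vp A Pc (c3 * kappa `^ (alpha + 2) * E)
              - c2 * Nu nb mu Vp A Pc (c4 * kappa `^ (alpha + 4) * E)) /\
         (cs * kappa ^- 4 < E ->
            IDS nb mu Vp A E >=
              c1' * Nu nb mu Vp A Pc (c3' * kappa ^+ 2 * E)
              - c2' * Nu nb mu Vp A Pc (c4' * kappa ^+ 4 * E))).
Proof.
move=> simple conn infV alpha1 [CL [CU [CL0 CU0 vol]]] [CP [lam [CP0 lam1 poinc]]] b covs.
split.
  exists (UBconst alpha CL CU CP lam b); split; first exact: UBconst_gt0.
  move=> A mu Vp Pc adm hP E E0.
  have CE0 : 0 < UBconst alpha CL CU CP lam b * E by apply: mulr_gt0 => //; exact: UBconst_gt0.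
  apply: ler_wpM2r; first by rewrite invr_ge0.
  rewrite ler_nat; apply: (@eig_count_le_bad V nb R alpha CL CU CP lam b) => //.
  by apply: hP; rewrite powR_gt0.
pose K := LBconst alpha CL CU CP lam b.
have K0 : 0 < K by exact: LBconst_gt0.
pose N := Netconst alpha CL CU b.
have N0 : 0 < N by exact: Netconst_gt0.
(* The common source of both regimes, used with [E4 = kappa^2 * E3], and with [rho = 1/kappa] in the
   first and [rho = 1] in the second. *)
have law (A : seq V) mu Vp Pc (E E3 E4 rho : R) :
  admissible nb mu Vp A -> (forall Rr : R, 0 < Rr -> covering nb (Pc Rr) Rr b) ->
  0 < E -> 0 < E3 -> 0 < E4 -> 1 <= rho ->
  2 * E3 `^ (- 2^-1) <= E4 `^ (- 2^-1) ->
  Num.max 1 (E4 `^ (- 2^-1)) <= rho * Num.max 1 (E3 `^ (- 2^-1)) ->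
  K * rho `^ alpha * E4^-1 <= E * E3 ^- 2 ->
  N * rho `^ (- alpha) * Nu nb mu Vp A Pc E3 - 1 * Nu nb mu Vp A Pc E4
    <= IDS nb mu Vp A E.
  move=> adm hP E0 E30 E40 rho1 h1 h2 h3.
  rewrite /Nu /Nu_cov /IDS mul1r mulrA -mulrBl.
  apply: ler_wpM2r; first by rewrite invr_ge0.
  by apply: (@eig_count_ge_bad V nb R alpha CL CU CP lam b) => //;
    apply: hP; rewrite powR_gt0.
have half (k e : R) : 0 < k -> 0 < e ->
    (k ^+ 2 * e) `^ (- 2^-1) = k^-1 * e `^ (- 2^-1).
  move=> k0 e0; rewrite powRM ?exprn_ge0 ?(ltW k0) ?(ltW e0) //; congr (_ * _).
  rewrite -powR_mulrn ?(ltW k0) // -powRrM mulrN mulfV // powR_inv1 // ltW //.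
have K10 : 0 < K^-1 by rewrite invr_gt0.
(* The factors [K^-1] turn the last condition of [law] into an equality in both regimes. *)
exists N, 1, K^-1, K^-1, N, 1, K^-1, K^-1, K; split=> //.
move=> A mu Vp Pc adm hP k k0 k4 E E0.
have ki4 : 4 <= k^-1 by rewrite -[4]invrK lef_pV2 ?posrE ?invr_gt0 // ltW.
have half2 (e : R) : 0 < e -> 2 * e `^ (- 2^-1) <= (k ^+ 2 * e) `^ (- 2^-1).
  move=> e0; rewrite half //; apply: ler_wpM2r; first exact: powR_ge0.
  by apply: le_trans ki4; rewrite ler_nat.
split=> hE.
  have p0 : 0 < k `^ alpha by rewrite powR_gt0.
  have kD (n : nat) : k `^ (alpha + n%:R) = k `^ alpha * k ^+ n.
    by rewrite powRD ?powR_mulrn ?(ltW k0) // (gt_eqF k0) implybT.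
  rewrite !(kD 2%N) (kD 4%N).
  have e3 : 0 < K^-1 * (k `^ alpha * k ^+ 2) * E by rewrite !mulr_gt0 ?exprn_gt0.
  have e4 : K^-1 * (k `^ alpha * k ^+ 4) * E = k ^+ 2 * (K^-1 * (k `^ alpha * k ^+ 2) * E).
    by ring.
  have kN : k `^ alpha = k^-1 `^ (- alpha).
    by rewrite -powR_inv1 ?(ltW k0) // -powRrM mulrNN mul1r.
  rewrite [N * k `^ alpha]/(N * _) {1}kN; apply: law => //.
  - by rewrite e4 mulr_gt0 ?exprn_gt0.
  - by apply: le_trans ki4; rewrite ler1n.
  - by rewrite e4; exact: half2.
  - rewrite e4 half // ge_max; apply/andP; split.
      apply: (@le_trans _ _ k^-1); first by apply: le_trans ki4; rewrite ler1n.
      by rewrite ler_peMr ?invr_ge0 ?(ltW k0) // le_max lexx.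
    by apply: ler_wpM2l; rewrite ?invr_ge0 ?(ltW k0) // le_max lexx orbT.
  - have -> : k^-1 `^ alpha = (k `^ alpha)^-1.
      by rewrite -powR_inv1 ?(ltW k0) // -powRrM mulN1r powRN.
    rewrite le_eqVlt; apply/orP; left; apply/eqP.
    by field; rewrite !gt_eqF.
have e3 : 0 < K^-1 * k ^+ 2 * E by rewrite !mulr_gt0 ?exprn_gt0.
have e4 : K^-1 * k ^+ 4 * E = k ^+ 2 * (K^-1 * k ^+ 2 * E) by ring.
(* This is where the threshold [cs = K] comes from: above it [E4 >= 1], so both radii are at most 1
   and the capped radii coincide. *)
have e41 : 1 <= K^-1 * k ^+ 4 * E.
  have k40 : 0 < k ^+ 4 by rewrite exprn_gt0.
  rewrite -mulrA mulrC ler_pdivlMr // mul1r mulrC -ler_pdivrMr //.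
  exact: ltW.
have r41 : (K^-1 * k ^+ 4 * E) `^ (- 2^-1) <= 1.
  have i1 : (K^-1 * k ^+ 4 * E)^-1 <= 1 by rewrite invf_le1 // (lt_le_trans ltr01).
  rewrite -(@ler_pXn2r _ 2) ?nnegrE ?powR_ge0 // expr1n sqr_powR_half //.
  by rewrite (lt_le_trans ltr01).
rewrite -[N in N * Nu _ _ _ _ _ _]mulr1 -{1}(_ : (1 : R) `^ (- alpha) = 1); last by rewrite powR1.
apply: law => //.
- by rewrite (lt_le_trans ltr01).
- by rewrite e4; exact: half2.
- by rewrite mul1r (max_l r41) le_max lexx.
- rewrite powR1 mulr1 le_eqVlt; apply/orP; left; apply/eqP.
  by field; rewrite !gt_eqF.
Qed.
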